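(* For every $d\in\mathbb{N}$ consider the random walk $S_k^{(d)}:=X_1^{(d)}+\dots+X_k^{(d)}$ in $\mathbb{R}^d$ with increments $X_i^{(d)}:=R_iV_i^{(d)}$, $i\in\mathbb{N}$, where $(R_i)_{i=1}^\infty$ are independent copies of a real random variable $R$ (whose distribution does not depend on $d$) with $\mathbb{E}R=0$ and $\mathbb{E}R^2=1$; $(V_i^{(d)})_{i=1}^\infty$ are i.i.d. random vectors with $\mathbb{P}[V_i^{(d)}=e_j]=1/d$ for $j\in\{1,\dots,d\}$, where $e_1,\dots,e_d$ is the standard orthonormal basis of $\mathbb{R}^d$; and $(R_i)_{i=1}^\infty$ and $(V_i^{(d)})_{i=1}^\infty$ are independent. Suppose that $\mathbb{E}R^4<\infty$, and let $n=n(d)$ be a sequence of positive integers with $n(d)\to\infty$ as $d\to\infty$. (a) If $\lim_{d\to\infty}n/d=0$, then, as $d\to\infty$, $$\frac{\|S_n^{(d)}\|^2-n}{\sqrt n}\ \overset{w}{\longrightarrow}\ \mathrm{N}(0,\mathrm{Var}(R^2)).$$ (b) If $\lim_{d\to\infty}n/d=\infty$, then, as $d\to\infty$, $$\frac{\|S_n^{(d)}\|^2-n}{\sqrt{2n^2/d}}\ \overset{w}{\longrightarrow}\ \mathrm{N}(0,1).$$ (c) If $n\sim\gamma d$ for some constant $\gamma\in(0,\infty)$, then, as $d\to\infty$, $$\frac{\|S_n^{(d)}\|^2-n}{\sqrt n}\ \overset{w}{\longrightarrow}\ \mathrm{N}(0,2\gamma+\mathrm{Var}(R^2)).$$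
   Context: $\|\cdot\|$ is the Euclidean norm, $\overset{w}{\longrightarrow}$ denotes convergence in distribution, $\mathrm{N}(0,\sigma^2)$ is the centered normal distribution with variance $\sigma^2$ (the point mass at $0$ if $\sigma^2=0$), and $n\sim\gamma d$ means $n/d\to\gamma$ as $d\to\infty$. *)

(* Defs.v *)
From HB Require Import structures.
From mathcomp Require Import all_boot all_order all_algebra finmap.
From mathcomp Require Import all_classical all_reals all_analysis.
From mathcomp Require Import measurable_realfun.

Set Implicit Arguments.
Unset Strict Implicit.
Unset Printing Implicit Defensive.

Import Order.TTheory GRing.Theory Num.Theory.
Import numFieldNormedType.Exports.

Local Open Scope classical_set_scope.
Local Open Scope ring_scope.

(* ['rV[K]_d] with its Borel sigma-algebra.  The open sets are those of the
   sup norm, which is the norm the library puts on matrices; all norms on R^d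
   have the same open sets. *)
Definition borel_rV (K : realType) (d : nat) :=
  g_sigma_algebraType (@open 'rV[K]_d).

(* The library norm on ['rV] is the sup norm. *)
Definition enorm (K : realType) (d : nat) (v : 'rV[K]_d) : K :=
  Num.sqrt (\sum_(j < d) v 0 j ^+ 2).

Section independence.
Context {dO : measure_display} {Omega : measurableType dO} {K : realType}.
Variable P : probability Omega K.

Definition sigma_rv {d'} {T' : measurableType d'} (X : Omega -> T') :
    set_system Omega :=
  preimage_set_system [set: Omega] X measurable.

Definition sigma_seq {d'} {T' : measurableType d'} (X : nat -> Omega -> T') :
    set_system Omega :=
  <<s \bigcup_i sigma_rv (X i) >>.

Definition independent_seq {d'} {T' : measurableType d'}
    (X : nat -> Omega -> T') : Prop :=
  forall (J : {fset nat}) (A : nat -> set Omega),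
    (forall i, i \in J -> sigma_rv (X i) (A i)) ->
    (P (\bigcap_(i in [set` J]) A i) = \prod_(i <- J) P (A i))%E.

Definition independent2 (F G : set_system Omega) : Prop :=
  forall A B, F A -> G B -> (P (A `&` B) = P A * P B)%E.

(* [P] is only meaningful on measurable sets, so [X] and [Y] having the same
   law is not equality of [distribution] as functions on all sets. *)
Definition same_law {d0} {Omega0 : measurableType d0} {d'}
    {T' : measurableType d'} (P0 : probability Omega0 K)
    (X : {RV P >-> T'}) (Y : {RV P0 >-> T'}) : Prop :=
  forall B : set T', measurable B -> distribution P X B = distribution P0 Y B.

(* Weak convergence of the law of [X d] to [mu] as [d] tends to infinity.  It
   is meant for measurable [X d]; for the random variables built from the walk
   see [measurable_enorm_walk] below. *)
Definition cvg_in_law (X : nat -> Omega -> K)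
    (mu : probability (measurableTypeR K) K) : Prop :=
  forall f : K -> K, continuous f -> bounded_fun f ->
    ('E_P[f \o X d] @[d --> \oo] --> \int[mu]_x (f x)%:E)%E.

End independence.

(* N(0, v), parametrized by the variance [v]; the library's [normal_prob m s]
   takes the standard deviation and is the uniform law on [0, 1] if [s = 0]. *)
Definition centered_normal (K : realType) (v : K) :
    probability (measurableTypeR K) K :=
  if v == 0
  then [the probability (measurableTypeR K) K of \d_(0 : measurableTypeR K)]
  else [the probability (measurableTypeR K) K of normal_prob 0 (Num.sqrt v)].

(* Increments are indexed from 0, so the walk at time [k] sums indices
   0, ..., k - 1. *)
Definition increment (K : realType) (Omega : Type) (d : nat)
    (R : nat -> Omega -> K) (V : nat -> Omega -> 'rV[K]_d) (i : nat)
    (w : Omega) : 'rV[K]_d :=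
  R i w *: V i w.

Definition walk (K : realType) (Omega : Type) (d : nat)
    (R : nat -> Omega -> K) (V : nat -> Omega -> 'rV[K]_d) (k : nat)
    (w : Omega) : 'rV[K]_d :=
  \sum_(i < k) increment R V i w.

Lemma measurable_coord_rV (K : realType) (d : nat) (j : 'I_d) :
  measurable_fun [set: borel_rV K d] (fun v : borel_rV K d => (v : 'rV[K]_d) 0 j).
Proof.
apply: (measurability _ (measurable_realfun.RGenOpens.measurableE K)) => _ [_ [a [b ->]] <-].
rewrite setTI; apply: sub_sigma_algebra.
have /continuousP := @coord_continuous K 1 d 0 j.
by apply; apply: interval_open.
Qed.

Lemma measurable_enorm_walk (K : realType) (dO : measure_display)
    (Omega : measurableType dO) (P : probability Omega K) (d : nat)
    (R : nat -> {RV P >-> K}) (V : nat -> {RV P >-> borel_rV K d}) (k : nat) :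
  measurable_fun [set: Omega] (fun w => enorm (walk R V k w)).
Proof.
rewrite /enorm.
apply: (@measurableT_comp _ _ _ _ _ _ (@Num.sqrt K)).
  by apply: continuous_measurable_fun; exact: sqrt_continuous.
apply: measurable_sum => j; apply: measurable_funX.
rewrite (_ : (fun _ => _) = (fun w => \sum_(i < k) R i w * (V i w : 'rV[K]_d) 0 j)).
  apply: measurable_sum => i; apply: measurable_funM => //.
  by apply: (measurableT_comp (measurable_coord_rV j)).
by apply/funext => w; rewrite /walk summxE; apply: eq_bigr => i _; rewrite mxE.
Qed.

(* Main.v *)
(* Since the steps are R_k V_k with V_k a uniform basis vector, Y_k = |S_k|^2 - k
   is a martingale with increments D_k = (R_k^2 - 1) + 2 R_k <V_k, S_k>, and the
   conditional variance of D_k given the past is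
     E (R^2 - 1)^2 + 4 (E R^3 <1, S_k> + |S_k|^2) / d,
   which is within a negligible L^1 error of its mean v_k = E (R^2 - 1)^2 + 4 k / d.
   The sum of the v_k over k < n is Var(R^2) n + 2 n (n - 1) / d; the three regimes
   differ only in which of the two terms dominates.

   Lindeberg's method is run with the Gaussian kernels x |-> g_w (x - a) as test
   functions.  They are solutions of the heat equation, so replacing D_k / c by a
   change v_k / c^2 of the variance parameter w costs only a Taylor remainder and the
   error in the conditional variance; after n steps E g_w (Y_n / c - a) is close to
   g_(w + v) (a), with no Gaussian random variable involved.  Convolving with g_w and
   letting w tend to 0 recovers all bounded continuous test functions, tightness
   being given by the second moment of Y_n / c. *)

Require Import Defs.
From HB Require Import structures.
From mathcomp Require Import all_boot all_order all_algebra finmap.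
From mathcomp Require Import all_classical all_reals all_analysis.
From mathcomp Require Import ring lra measurable_realfun.

Set Implicit Arguments.
Unset Strict Implicit.
Unset Printing Implicit Defensive.

Import Order.TTheory GRing.Theory Num.Theory.
Import numFieldNormedType.Exports.

Local Open Scope classical_set_scope.
Local Open Scope ring_scope.

(** * Taylor bounds for the Gaussian kernel *)

(** The moments of D_k given the past never appear as conditional expectations. They are stated as
    formulas for E (X D_k) and E (X D_k^2), for X measurable with respect to the first k radii and
    directions, and proved by the product rule for independent variables. To apply that rule when
    V_k selects a coordinate of S_k, the direction is replaced by its index in ['I_d], so that
    averaging over V_k is a finite sum divided by d. The conditional variance is close to v_k
    because it deviates from it by 4 (E R^3 <1, S_k> + |S_k|^2 - k) / d, and both parts are
    controlled in L^2: E <1, S_k>^2 = k, and E (|S_k|^2 - k)^2 is computed from the same increments.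
    The obstacle is integrability: R has four moments, so R^2 - 1 has only two and D_k has no third
    moment. Hence the Taylor remainder h^2 min(1, |h|), a truncation level e for R^2 - 1, and a
    fourth moment for the cross term alone. The regimes enter only through bounds on n / c^2 and n^2
    / (c^2 d), the limit of the total variance, and c tending to infinity. *)

Section pointwise_derivatives.
Variables (K : realType) (f g : K -> K) (x df dg : K).
Hypotheses (fx : is_derive x 1 f df) (gx : is_derive x 1 g dg).

Lemma is_derive1D : is_derive x 1 (fun t => f t + g t) (df + dg).
Proof. exact: (is_deriveD fx gx). Qed.

Lemma is_derive1B : is_derive x 1 (fun t => f t - g t) (df - dg).
Proof. exact: (is_deriveB fx gx). Qed.

Lemma is_derive1N : is_derive x 1 (fun t => - f t) (- df).
Proof. exact: (is_deriveN fx). Qed.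

Lemma is_derive1M : is_derive x 1 (fun t => f t * g t) (f x * dg + df * g x).
Proof. by apply: (is_derive_eq (is_deriveM fx gx)); rewrite /GRing.scale/= [df * _]mulrC. Qed.

Lemma is_derive1X n : is_derive x 1 (fun t => f t ^+ n.+1) (n.+1%:R * f x ^+ n * df).
Proof. by have := is_deriveX n.+1 fx; rewrite exprfctE. Qed.

Lemma is_derive1_expR : is_derive x 1 (fun t => expR (f t)) (expR (f x) * df).
Proof. exact: is_derive1_comp. Qed.

Lemma is_derive1V : f x != 0 -> is_derive x 1 (fun t => (f t)^-1) (- (f x) ^- 2 * df).
Proof. by move=> fx0; apply: (is_derive_eq (is_deriveV fx0 fx)). Qed.

End pointwise_derivatives.

Lemma MVT_bound (K : realType) (f df : K -> K) (B a b : K) : a <= b ->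
  (forall t : K, a <= t <= b -> is_derive t 1 f (df t)) ->
  (forall t, a <= t <= b -> `|df t| <= B) ->
  `|f b - f a| <= B * (b - a).
Proof.
move=> ab fdf dfB.
have [c cab ->] : exists2 c, c \in `[a, b]%R & f b - f a = df c * (b - a).
  apply: MVT_segment => // [x /andP[ax xb]|].
    by apply: fdf; rewrite !bnd_simp in ax xb; rewrite !ltW.
  apply: derivable_within_continuous => x xab.
  by case: (fdf x) => //; move: xab; rewrite in_itv.
rewrite normrM [X in _ * X]ger0_norm ?subr_ge0//.
by apply: ler_wpM2r; rewrite ?subr_ge0// dfB//; move: cab; rewrite in_itv.
Qed.

Lemma MVT_bound_sym (K : realType) (f df : K -> K) (B h : K) :
  (forall t : K, is_derive t 1 f (df t)) ->
  (forall t, `|t| <= `|h| -> `|df t| <= B) ->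
  `|f h - f 0| <= B * `|h|.
Proof.
move=> fdf dfB; have [h0|h0] := leP 0 h.
- have := @MVT_bound K f df B 0 h h0 (fun t _ => fdf t).
  rewrite subr0 (ger0_norm h0); apply => t /andP[t0 th].
  by apply: dfB; rewrite !ger0_norm.
- have := @MVT_bound K f df B h 0 (ltW h0) (fun t _ => fdf t).
  rewrite distrC sub0r (ltr0_norm h0); apply => t /andP[t0 th].
  by apply: dfB; rewrite !ler0_norm// ?lerN2// ltW.
Qed.

Section taylor2.
Variables (K : realType) (f f1 f2 f3 : K -> K) (C : K).
Hypothesis df : forall t : K, is_derive t 1 f (f1 t).
Hypothesis df1 : forall t : K, is_derive t 1 f1 (f2 t).
Hypothesis df2 : forall t : K, is_derive t 1 f2 (f3 t).
Hypothesis f2C : forall t, `|f2 t| <= C.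
Hypothesis f3C : forall t, `|f3 t| <= C.

(** The mean value inequality is applied to the errors in [f2], [f1] and [f] in turn. The minimum
    comes from the first: [f2 (x + t) - f2 x] is at most 2 C by boundedness and at most C |t| by the
    bound on [f3]. It keeps the remainder quadratic for large h, where only second moments will be
    at hand. *)
Lemma taylor2_bound x h :
  `|f (x + h) - f x - h * f1 x - h ^+ 2 / 2 * f2 x| <=
  2 * C * (h ^+ 2 * Num.min 1 `|h|).
Proof.
have C0 : 0 <= C by rewrite (le_trans _ (f2C 0)).
have shift (g g' : K -> K) (t : K) : (forall t : K, is_derive t 1 g (g' t)) ->
    is_derive t 1 (fun u => g (x + u)) (g' (x + t)).
  move=> dg; have := @is_derive1_comp K g (fun u => x + u) t (g' (x + t)) 1 (dg _).
  rewrite mulr1; apply.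
  by rewrite -[X in is_derive _ _ _ X]add0r; exact: is_derive1D.
have D2 t : `|f2 (x + t) - f2 x| <= 2 * C * Num.min 1 `|t|.
  rewrite minr_pMr ?mulr_ge0// mulr1 le_min; apply/andP; split.
    by rewrite (le_trans (ler_normB _ _))// mulr_natl mulr2n lerD.
  have /= := @MVT_bound_sym K (fun u => f2 (x + u)) (fun u => f3 (x + u)) C t.
  rewrite addr0 => /(_ (fun u : K => shift _ _ u df2) (fun _ _ => f3C _)) /le_trans; apply.
  by rewrite ler_wpM2r// ler_peMl// ler1n.
have D1 t : `|f1 (x + t) - f1 x - t * f2 x| <= 2 * C * Num.min 1 `|t| * `|t|.
  have /= := @MVT_bound_sym K (fun u => f1 (x + u) - u * f2 x)
    (fun u => f2 (x + u) - f2 x) (2 * C * Num.min 1 `|t|) t.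
  rewrite addr0 mul0r subr0 addrAC; apply => [u|u ut].
    apply: (is_derive_eq (is_derive1B (shift _ _ u df1)
      (is_derive1M (is_derive_id u 1) (is_derive_cst (f2 x) u 1)))).
    by rewrite /=; ring.
  apply: (le_trans (D2 u)); apply: ler_wpM2l; first by rewrite mulr_ge0.
  by rewrite le_min !ge_min lexx ut orbT.
have D0 (u : K) : is_derive u 1 (fun u => f (x + u) - u * f1 x - u * u * 2^-1 * f2 x)
    (f1 (x + u) - f1 x - u * f2 x).
  apply: (is_derive_eq (is_derive1B (is_derive1B (shift _ _ u df)
      (is_derive1M (is_derive_id u 1) (is_derive_cst (f1 x) u 1)))
    (is_derive1M (is_derive1M (is_derive1M (is_derive_id u 1) (is_derive_id u 1))
      (is_derive_cst (2^-1 : K) u 1)) (is_derive_cst (f2 x) u 1)))).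
  by rewrite /=; field.
have := @MVT_bound_sym K _ _ (2 * C * (Num.min 1 `|h| * `|h|)) h D0.
rewrite addr0 !mul0r !subr0.
have <- : 2 * C * (Num.min 1 `|h| * `|h|) * `|h| = 2 * C * (h ^+ 2 * Num.min 1 `|h|).
  by rewrite -(real_normK (num_real h)); ring.
rewrite (_ : f (x + h) - h * f1 x - h * h * 2^-1 * f2 x - f x =
  f (x + h) - f x - h * f1 x - h ^+ 2 / 2 * f2 x); last by ring.
apply => u uh.
rewrite (le_trans (D1 u))// -mulrA ler_wpM2l ?mulr_ge0//.
by rewrite ler_pM// ?le_min ?ler01 ?normr_ge0// !ge_min lexx uh orbT.
Qed.

End taylor2.

Section gaussian_kernel.
Variable K : realType.
Implicit Types w x v h : K.

(* Up to the factor [sqrt (2 * pi)], the density of N(0, w); [gauss1], ...,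
   [gauss4] are its derivatives in [x], and the heat equation makes
   [gauss2 / 2] its derivative in [w]. *)
Definition gauss w x := expR (- (ln w / 2) - x ^+ 2 / (2 * w)).
Definition gauss1 w x := - (x / w) * gauss w x.
Definition gauss2 w x := (x ^+ 2 / w ^+ 2 - w^-1) * gauss w x.
Definition gauss3 w x := (3 * x / w ^+ 2 - x ^+ 3 / w ^+ 3) * gauss w x.
Definition gauss4 w x :=
  (x ^+ 4 / w ^+ 4 - 6 * x ^+ 2 / w ^+ 3 + 3 / w ^+ 2) * gauss w x.

Let did (x : K) := @is_derive_id K K x 1.
Let dcst (c x : K) := @is_derive_cst K K K c x 1.

Lemma is_derive_gauss w x : w != 0 -> is_derive x 1 (gauss w) (gauss1 w x).
Proof.
move=> w0.
apply: (is_derive_eq (is_derive1_expR (is_derive1B (dcst (- (ln w / 2)) x)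
  (is_derive1M (is_derive1X (did x) 1) (dcst (2 * w)^-1 x))))).
by rewrite /= /gauss1 /gauss /=; field.
Qed.

Lemma is_derive_gauss1 w x : w != 0 -> is_derive x 1 (gauss1 w) (gauss2 w x).
Proof.
move=> w0.
apply: (is_derive_eq (is_derive1M
  (is_derive1N (is_derive1M (did x) (dcst w^-1 x))) (is_derive_gauss x w0))).
by rewrite /= /gauss1 /gauss2; field.
Qed.

Lemma is_derive_gauss2 w x : w != 0 -> is_derive x 1 (gauss2 w) (gauss3 w x).
Proof.
move=> w0.
apply: (is_derive_eq (is_derive1M
  (is_derive1B (is_derive1M (is_derive1X (did x) 1) (dcst (w ^+ 2)^-1 x)) (dcst w^-1 x))
  (is_derive_gauss x w0))).
by rewrite /= /gauss3 /gauss1 /gauss2; field.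
Qed.

Lemma is_derive_gauss_var w x : 0 < w ->
  is_derive w 1 (fun u => gauss u x) (gauss2 w x / 2).
Proof.
move=> w0; have wn0 : w != 0 by rewrite gt_eqF.
have w20 : 2 * w != 0 by rewrite mulf_neq0// pnatr_eq0.
apply: (is_derive_eq (is_derive1_expR (is_derive1B
  (is_derive1N (is_derive1M (is_derive1_ln w0) (dcst 2^-1 w)))
  (is_derive1M (dcst (x ^+ 2) w) (is_derive1V (is_derive1M (dcst 2 w) (did w)) w20))))).
by rewrite /= /gauss2 /gauss /=; field.
Qed.

Lemma is_derive_gauss2_var w x : 0 < w ->
  is_derive w 1 (fun u => gauss2 u x / 2) (gauss4 w x / 4).
Proof.
move=> w0; have wn0 : w != 0 by rewrite gt_eqF.
have w2n0 : w ^+ 2 != 0 by rewrite expf_neq0.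
apply: (is_derive_eq (is_derive1M (is_derive1M
  (is_derive1B (is_derive1M (dcst (x ^+ 2) w) (is_derive1V (is_derive1X (did w) 1) w2n0))
    (is_derive1V (did w) wn0)) (is_derive_gauss_var x w0)) (dcst 2^-1 w))).
by rewrite /= /gauss2 /gauss4; field.
Qed.

Lemma gauss_ge0 w x : 0 <= gauss w x. Proof. exact: expR_ge0. Qed.

(** Uniformity in w >= w0 is needed because the variance parameter varies along the Lindeberg steps
    but never falls below w0. With z = x^2 / (2 w), each prefactor is a polynomial in z and w^-1, up
    to a factor x in the odd orders, which |x| <= (1 + x^2) / 2 absorbs; and z e^-z <= 1, z^2 e^-z
    <= 2. The factor 30 (1 + w0^-1)^2 is a crude common majorant. *)
Lemma gauss_bounds (w0 : K) : 0 < w0 -> exists2 C : K, 0 <= C &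
  forall w x, w0 <= w -> [/\ gauss w x <= C, `|gauss1 w x| <= C, `|gauss2 w x| <= C,
    `|gauss3 w x| <= C & `|gauss4 w x| <= C].
Proof.
move=> w00; set A := expR (- (ln w0 / 2)); set i := w0^-1.
have A0 : 0 <= A by exact: expR_ge0.
have i0 : 0 <= i by rewrite invr_ge0 ltW.
exists (A * (30 * (1 + i) ^+ 2)); first by rewrite mulr_ge0// mulr_ge0// sqr_ge0.
move=> w x w0w; have wp : 0 < w by rewrite (lt_le_trans w00).
have wn0 : w != 0 by rewrite gt_eqF.
set z := x ^+ 2 / (2 * w); set e := expR (- z).
have z0 : 0 <= z by rewrite divr_ge0 ?sqr_ge0// mulr_ge0// ltW.
have e0 : 0 <= e by exact: expR_ge0.
have e1 : e <= 1 by rewrite /e expR_le1 oppr_le0.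
have ez : z * e <= 1.
  rewrite /e expRN ler_pdivrMr ?expR_gt0// mul1r.
  by rewrite (le_trans _ (expR_ge1Dx z))// lerDr.
have ezz : z ^+ 2 * e <= 2.
  rewrite /e expRN ler_pdivrMr ?expR_gt0//.
  have := expR_ge1Dxn 1 z0; rewrite -[(2`!)%:R]/(2%:R : K); lra.
have iw : w^-1 <= i by rewrite lef_pV2.
have iw0 : 0 <= w^-1 by rewrite invr_ge0 ltW.
have GE : gauss w x <= A * e.
  rewrite /gauss expRD ler_wpM2r// ler_expR lerN2 ler_pM2r ?invr_gt0//.
  by rewrite ler_ln ?posrE.
have bound q : `|q| * e <= 30 * (1 + i) ^+ 2 ->
    `|q * gauss w x| <= A * (30 * (1 + i) ^+ 2).
  move=> qe; rewrite normrM (ger0_norm (gauss_ge0 _ _)).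
  apply: (@le_trans _ _ (`|q| * (A * e))); first by rewrite ler_wpM2l.
  by rewrite mulrCA ler_wpM2l.
have xE : x ^+ 2 = 2 * w * z by rewrite /z; field.
have x1 : `|x| <= (1 + x ^+ 2) / 2.
  by have := sqr_ge0 (`|x| - 1); rewrite -(real_normK (num_real x)); lra.
have ie : e * i <= i by rewrite ler_piMl.
have zi : z * e * i <= i by rewrite ler_piMl.
have zi2 : z * e * i ^+ 2 <= i ^+ 2 by rewrite ler_piMl// sqr_ge0.
have ei2 : e * i ^+ 2 <= i ^+ 2 by rewrite ler_piMl// sqr_ge0.
have zzi : z ^+ 2 * e * i <= 2 * i by rewrite ler_wpM2r.
have zzi2 : z ^+ 2 * e * i ^+ 2 <= 2 * i ^+ 2 by rewrite ler_wpM2r ?sqr_ge0.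
have iw2 : w^-1 ^+ 2 <= i ^+ 2 by rewrite lerXn2r ?nnegrE.
have i2 := sqr_ge0 i.
have iww : 0 <= w^-1 ^+ 2 by rewrite sqr_ge0.
split.
- rewrite (le_trans GE)// ler_wpM2l//; nra.
- apply: bound; rewrite normrN normrM (ger0_norm iw0).
  have : `|x| * w^-1 <= i / 2 + z.
    apply: (le_trans (ler_wpM2r iw0 x1)).
    rewrite xE (_ : _ / _ / _ = w^-1 / 2 + z); first lra.
    by field.
  move/(ler_wpM2r e0) => /le_trans; apply; nra.
- apply: bound.
  have -> : x ^+ 2 / w ^+ 2 - w^-1 = w^-1 * (2 * z - 1) by rewrite xE; field.
  rewrite normrM (ger0_norm iw0).
  have : w^-1 * `|2 * z - 1| <= i * (2 * z + 1).
    by rewrite ler_pM// (le_trans (ler_normB _ _))// normr1 ger0_norm// mulr_ge0.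
  move/(ler_wpM2r e0) => /le_trans; apply; nra.
- apply: bound.
  have -> : 3 * x / w ^+ 2 - x ^+ 3 / w ^+ 3 = x * (w^-1 ^+ 2 * (3 - 2 * z)).
    by rewrite (exprS x) xE; field.
  rewrite normrM (normrM (w^-1 ^+ 2)) (ger0_norm iww).
  have : `|3 - 2 * z| <= 3 + 2 * z.
    by rewrite (le_trans (ler_normB _ _))// !ger0_norm// mulr_ge0.
  have : `|x| * w^-1 ^+ 2 <= (i ^+ 2 + 2 * z * i) / 2.
    apply: (le_trans (ler_wpM2r iww x1)).
    rewrite xE (_ : _ / _ * _ = (w^-1 ^+ 2 + 2 * z * w^-1) / 2); last by field.
    have : z * w^-1 <= z * i by rewrite ler_wpM2l.
    lra.
  move=> h1 h2; rewrite mulrA.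
  have := ler_pM (mulr_ge0 (normr_ge0 x) iww) (normr_ge0 _) h1 h2.
  move/(ler_wpM2r e0) => /le_trans; apply; nra.
- apply: bound.
  have -> : x ^+ 4 / w ^+ 4 - 6 * x ^+ 2 / w ^+ 3 + 3 / w ^+ 2 =
      w^-1 ^+ 2 * (4 * z ^+ 2 - 12 * z + 3).
    by rewrite -[4%N]/(2 * 2)%N exprM xE; field.
  rewrite normrM (ger0_norm iww).
  have : w^-1 ^+ 2 * `|4 * z ^+ 2 - 12 * z + 3| <= i ^+ 2 * (4 * z ^+ 2 + 12 * z + 3).
    rewrite ler_pM// ler_norml; have := sqr_ge0 z; lra.
  move/(ler_wpM2r e0) => /le_trans; apply; nra.
Qed.

(** By the heat equation, a move h in space and a change v of the variance have the same
    second-order factor [gauss2 w x / 2]. They combine into (h^2 - v) / 2, which averages out when v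
    is the variance of h. The expansion in v uses the mean value inequality twice, [gauss4 / 4]
    being the second derivative in the variance. *)
Lemma gauss_taylor (w0 : K) : 0 < w0 -> exists2 C : K, 0 <= C &
  forall w x h v, w0 <= w -> 0 <= v ->
  `|gauss w (x + h) - gauss (w + v) x - h * gauss1 w x - (h ^+ 2 - v) / 2 * gauss2 w x|
  <= C * (h ^+ 2 * Num.min 1 `|h| + v ^+ 2).
Proof.
move=> w00; have [C C0 HC] := gauss_bounds w00; exists (2 * C).
  by rewrite mulr_ge0.
move=> w x h v w0w v0; have wp : 0 < w by rewrite (lt_le_trans w00).
have wn0 : w != 0 by rewrite gt_eqF.
have H1 := @taylor2_bound K (gauss w) (gauss1 w) (gauss2 w) (gauss3 w) C
  (fun t => is_derive_gauss t wn0) (fun t => is_derive_gauss1 t wn0)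
  (fun t => is_derive_gauss2 t wn0)
  (fun t => let: And5 _ _ h _ _ := HC w t w0w in h)
  (fun t => let: And5 _ _ _ h _ := HC w t w0w in h) x h.
have D2 t : 0 <= t -> `|gauss2 (w + t) x / 2 - gauss2 w x / 2| <= C * t.
  move=> t0.
  have := @MVT_bound K (fun u => gauss2 u x / 2) (fun u => gauss4 u x / 4) C w (w + t).
  rewrite addrAC subrr add0r lerDl; apply => // u /andP[wu _].
    by apply: is_derive_gauss2_var; rewrite (lt_le_trans wp).
  have [_ _ _ _] := HC u x (le_trans w0w wu).
  by rewrite (normrM (gauss4 u x)) (@ger0_norm _ 4^-1) ?invr_ge0//; have := normr_ge0 (gauss4 u x); lra.
have H2 : `|gauss (w + v) x - gauss w x - v * (gauss2 w x / 2)| <= C * v * v.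
  have := @MVT_bound K (fun u => gauss u x - u * (gauss2 w x / 2))
    (fun u => gauss2 u x / 2 - gauss2 w x / 2) (C * v) w (w + v).
  rewrite (_ : _ - _ - _ = gauss (w + v) x - gauss w x - v * (gauss2 w x / 2)); last by ring.
  rewrite [w + v - w]addrAC subrr add0r lerDl; apply => // u /andP[wu uv].
    have up : 0 < u by rewrite (lt_le_trans wp).
    apply: (is_derive_eq (is_derive1B (is_derive_gauss_var x up)
      (is_derive1M (did u) (dcst (gauss2 w x / 2) u)))).
    by rewrite /=; ring.
  have := D2 (u - w); rewrite [w + _]addrC subrK subr_ge0 => /(_ wu) /le_trans; apply.
  by rewrite ler_wpM2l// lerBlDl.
rewrite (_ : _ - _ - _ - _ =
  (gauss w (x + h) - gauss w x - h * gauss1 w x - h ^+ 2 / 2 * gauss2 w x) -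
  (gauss (w + v) x - gauss w x - v * (gauss2 w x / 2))); last by ring.
rewrite (le_trans (ler_normB _ _))// mulrDr lerD//.
rewrite (le_trans H2)// expr2 -mulrA ler_wpM2r ?mulr_ge0//; lra.
Qed.

End gaussian_kernel.

(** * Gaussian kernels determine convergence in law *)

Section real_integrals.
Context d (T : measurableType d) (K : realType).
Variable mu : {measure set T -> \bar K}.
Implicit Types f g h : T -> K.

Lemma integrable_dominated f g : measurable_fun setT f ->
  mu.-integrable setT (EFin \o g) -> (forall x, `|f x| <= g x) ->
  mu.-integrable setT (EFin \o f).
Proof.
move=> mf ig fg; apply: le_integrable ig => //; first exact/measurable_EFinP.
by move=> x _; rewrite /= lee_fin (le_trans (fg x))// ler_norm.
Qed.

Lemma Rintegral_dist f g h : mu.-integrable setT (EFin \o f) ->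
  mu.-integrable setT (EFin \o g) -> mu.-integrable setT (EFin \o h) ->
  (forall x, `|f x - g x| <= h x) ->
  `|\int[mu]_x f x - \int[mu]_x g x| <= \int[mu]_x h x.
Proof.
move=> if_ ig ih fgh; rewrite -RintegralB//.
have ifg : mu.-integrable setT (EFin \o (fun x => f x - g x)).
  exact: (integrableB measurableT if_ ig).
apply: (le_trans (le_normr_Rintegral measurableT ifg)).
apply: le_Rintegral => //; exact: (integrable_norm ifg).
Qed.

End real_integrals.

Section probability_integrals.
Context d (T : measurableType d) (K : realType).
Variable P : probability T K.
Implicit Types f g h : T -> K.

Lemma bounded_integrable f (B : K) : measurable_fun setT f ->
  (forall x, `|f x| <= B) -> P.-integrable setT (EFin \o f).
Proof.
move=> mf fB; apply: measurable_bounded_integrable => //.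
  by rewrite (le_lt_trans (probability_le1 P measurableT))// ltry.
exists B; split; first exact: num_real.
by move=> y By x _; apply: (le_trans (fB x)); exact: ltW.
Qed.

Lemma Rintegral_cstT (c : K) : \int[P]_x c = c.
Proof. by rewrite Rintegral_cst// [X in fine X]probability_setT mulr1. Qed.

Lemma integrable_cstT (c : K) : P.-integrable setT (EFin \o (fun=> c)).
Proof. exact: (@bounded_integrable _ `|c|). Qed.

End probability_integrals.

Section gaussian_integrals.
Variable K : realType.
Notation leb := (@lebesgue_measure K).
Implicit Types w m x : K.

Lemma sqrt_expR w : 0 < w -> Num.sqrt w = expR (ln w / 2).
Proof.
move=> w0; rewrite -[LHS](_ : Num.sqrt (expR (ln w / 2) ^+ 2) = _).
  by rewrite sqrtr_sqr ger0_norm ?expR_ge0.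
by rewrite -expRM_natl mulrC divfK ?pnatr_eq0// lnK.
Qed.

Lemma normal_pdf_gauss w m x : 0 < w ->
  normal_pdf m (Num.sqrt w) x = (Num.sqrt (pi *+ 2))^-1 * gauss w (x - m).
Proof.
move=> w0; rewrite normal_pdfE ?gt_eqF ?sqrtr_gt0// /normal_peak /normal_fun.
rewrite sqr_sqrtr ?ltW// -mulrnAr sqrtrM ?ltW// invfM [_^-1 * _]mulrC -mulrA.
congr (_ * _); rewrite /gauss expRD expRN -sqrt_expR//; congr (_ * expR _).
by rewrite mulNr mulr_natl.
Qed.

Lemma sqrt2pi_gt0 : 0 < Num.sqrt (pi *+ 2) :> K.
Proof. by rewrite sqrtr_gt0 pmulrn_lgt0// pi_gt0. Qed.

Lemma measurable_gauss w : measurable_fun setT (gauss w).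
Proof.
rewrite (_ : gauss w = expR \o (fun x => - (ln w / 2) - x ^+ 2 * (2 * w)^-1))//.
apply: measurableT_comp => //; apply: measurable_funB => //.
by apply: measurable_funM => //; exact: measurable_funX.
Qed.

Lemma gaussE w m x : 0 < w ->
  gauss w (x - m) = Num.sqrt (pi *+ 2) * normal_pdf m (Num.sqrt w) x.
Proof.
by move=> w0; rewrite normal_pdf_gauss// mulVKf// gt_eqF// sqrt2pi_gt0.
Qed.

Lemma integrable_gauss w m : 0 < w ->
  leb.-integrable setT (EFin \o (fun x => gauss w (x - m))).
Proof.
move=> w0; rewrite (_ : _ \o _ = (fun x => (Num.sqrt (pi *+ 2))%:E *
   (normal_pdf m (Num.sqrt w) x)%:E)%E).
  by apply: integrableZl => //; exact: integrable_normal_pdf.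
by apply/funext => x /=; rewrite gaussE.
Qed.

Lemma Rintegral_gauss w m : 0 < w ->
  \int[leb]_x gauss w (x - m) = Num.sqrt (pi *+ 2).
Proof.
move=> w0; under eq_Rintegral do rewrite gaussE//.
rewrite RintegralZl//; last exact: integrable_normal_pdf.
by rewrite /Rintegral integral_normal_pdf /= mulr1.
Qed.

Lemma gaussN w x : gauss w (- x) = gauss w x.
Proof. by rewrite /gauss sqrrN. Qed.

End gaussian_integrals.

Lemma EFin_Rintegral d (T : measurableType d) (K : realType)
    (mu : {measure set T -> \bar K}) (f : T -> K) :
  mu.-integrable setT (EFin \o f) ->
  (\int[mu]_x f x)%:E = (\int[mu]_x (f x)%:E)%E.
Proof. by move=> fi; rewrite fineK//; exact: integrable_fin_num. Qed.

(** Only x is confined to the segment; y may leave it. Compactness in its near-covering form merges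
    the local radii into one, and r <= 1 lets the caller enlarge the segment by 1 so that it
    contains every such y. *)
Lemma continuous_unif_segment (K : realType) (f : K -> K) (M e : K) :
  continuous f -> 0 < e ->
  exists2 r : K, 0 < r <= 1 &
    forall x y, `|x| <= M -> `|x - y| <= r -> `|f x - f y| <= e.
Proof.
move=> cf e0.
have /compact_near_coveringP cpt := @segment_compact K (- M) M.
have := cpt K 0^'+ (fun r x => forall y, `|x - y| <= r -> `|f x - f y| <= e) (@at_right_proper_filter _ _).
have H : forall x : K, `[- M, M]%classic x -> \forall x' \near x & r \near 0^'+,
    forall y, `|x' - y| <= r -> `|f x' - f y| <= e.
  move=> x _; have e2 : 0 < e / 2 by rewrite divr_gt0.
  have /cvgrPdist_lt/(_ _ e2)/nbhs_ballP[s /= s0 sf] := cf x.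
  have s2 : 0 < s / 2 by rewrite divr_gt0.
  exists (ball x (s / 2), [set r | r < s / 2]).
    split; first exact: nbhsx_ballx.
    exact: nbhs_right_lt.
  move=> [x' r] [/= xx' rs] y yr.
  have := sf x'; have := sf y.
  rewrite /ball/= in xx' *.
  have xy : `|x - y| < s.
    rewrite (_ : x - y = (x - x') + (x' - y)); last by ring.
    rewrite (le_lt_trans (ler_normD _ _))// (splitr s) ltrD//.
    by rewrite (le_lt_trans yr).
  have xx : `|x - x'| < s by rewrite (lt_le_trans xx')// ler_pdivrMr// ler_peMr ?ler1n// ltW.
  move=> /(_ xy) fy /(_ xx) fx.
  rewrite (_ : f x' - f y = (f x - f y) - (f x - f x')); last by ring.
  by rewrite (le_trans (ler_normB _ _))// (splitr e) lerD// ltW.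
move=> /(_ H) N.
have [r [r0 [r1 rP]]] : exists r : K, 0 < r /\ r <= 1 /\
    (`[- M, M] `<=` (fun x => forall y, `|x - y| <= r -> `|f x - f y| <= e)).
  have : \forall r \near 0^'+, 0 < r /\ r <= 1 /\
    (`[- M, M] `<=` (fun x => forall y, `|x - y| <= r -> `|f x - f y| <= e)).
    near=> r; split; [|split]; last by near: r.
    - by near: r; exact: nbhs_right_gt.
    - by near: r; exact: nbhs_right_le.
  by move/filter_ex.
exists r; first by rewrite r0.
by move=> x y xM; apply: rP => /=; rewrite in_itv/= -ler_norml.
Unshelve. all: by end_near. Qed.

(** * Convolution of a bounded continuous function with a Gaussian kernel *)

Section smoothing.
Variable K : realType.
Notation leb := (@lebesgue_measure K).
Variables (f : K -> K) (B : K).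
Hypothesis cf : continuous f.
Hypothesis fB : forall x, `|f x| <= B.

Let B0 : 0 <= B. Proof. by rewrite (le_trans _ (fB 0)). Qed.

(** The cut-off provides an integrable majorant in the convolution variable, independent of d, for
    the later passage to the limit inside the integral of [Rintegral_smooth]. *)
Let ind (L : K) : K -> K := \1_`[- L, L].

Let ind01 (L x : K) : 0 <= ind L x <= 1.
Proof. by rewrite /ind indicE; case: (_ \in _); rewrite ?ler01 ?lexx. Qed.

Let mf : measurable_fun setT f.
Proof. exact: continuous_measurable_fun. Qed.

Let measurable_find L : measurable_fun setT (fun a => f a * ind L a).
Proof. by apply: measurable_funM => //; exact: measurable_indic. Qed.

Let find_le L a : `|f a * ind L a| <= B * ind L a.
Proof.
have /andP[i0 _] := ind01 L a.
by rewrite normrM [X in _ * X]ger0_norm// ler_wpM2r.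
Qed.

Lemma measurable_gauss_shift (w x : K) : measurable_fun setT (fun a : K => gauss w (a - x)).
Proof.
apply: (measurableT_comp (measurable_gauss w)).
by apply: measurable_funB.
Qed.

Let integrable_find (L w x : K) : 0 < w ->
  leb.-integrable setT (EFin \o (fun a => f a * ind L a * gauss w (a - x))).
Proof.
move=> w0; apply: (@integrable_dominated _ _ _ leb _ (fun a => B * gauss w (a - x))).
- by apply: measurable_funM; [exact: measurable_find|exact: measurable_gauss_shift].
- exact: (integrableZl measurableT B (integrable_gauss x w0)).
- move=> a; rewrite normrM (ger0_norm (gauss_ge0 _ _)) ler_wpM2r ?gauss_ge0//.
  rewrite (le_trans (find_le _ _))// ler_piMr//; by case/andP: (ind01 L a).
Qed.

(* The convolution of [f 1_[-L, L]] with the N(0, w) density. *)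
Definition smooth (w L x : K) : K :=
  (Num.sqrt (pi *+ 2))^-1 * \int[leb]_a (f a * ind L a * gauss w (a - x)).

(** Half of the exponent, e^-t with t = u^2 / (4 w), is at most 1 / t <= 4 w / r^2; the other half
    is the kernel with variance 2 w. The tail is thus majorized by w times a function whose integral
    is known exactly. *)
Lemma gauss_tail (w r u : K) : 0 < w -> 0 < r -> r <= `|u| ->
  gauss w u <= 4 * w / r ^+ 2 * (Num.sqrt 2 * gauss (2 * w) u).
Proof.
move=> w0 r0 ru.
have s2 : Num.sqrt 2 * expR (- (ln (2 * w) / 2)) = expR (- (ln w / 2)) :> K.
  rewrite sqrt_expR// -expRD; congr expR; rewrite lnM ?posrE//; ring.
rewrite /gauss expRD (expRD (- (ln (2 * w) / 2))) [Num.sqrt 2 * _]mulrA s2.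
rewrite [leRHS]mulrCA ler_wpM2l ?expR_ge0//.
set t := u ^+ 2 / (4 * w).
have -> : - (u ^+ 2 / (2 * w)) = (- t) + (- t) by rewrite /t; field; rewrite gt_eqF.
have -> : - (u ^+ 2 / (2 * (2 * w))) = - t by rewrite /t mulrA; congr (- (_ / (_ * _))); ring.
rewrite expRD ler_wpM2r ?expR_ge0//.
have u20 : 0 < u ^+ 2 by rewrite exprn_even_gt0//= -normr_gt0 (lt_le_trans r0).
have t0 : 0 < t by apply: divr_gt0 => //; rewrite mulr_gt0.
have : expR (- t) <= t^-1.
  rewrite expRN lef_pV2 ?posrE ?expR_gt0// (le_trans _ (expR_ge1Dx t))//.
  by rewrite lerDr.
move=> /le_trans; apply; rewrite /t invfM invrK mulrC ler_wpM2l ?mulr_ge0 ?(ltW w0)//.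
rewrite lef_pV2 ?posrE ?(exprn_gt0 _ r0)//.
by rewrite -(real_normK (num_real u)) lerXn2r ?nnegrE// ltW.
Qed.

Lemma smooth_le (w L x : K) : 0 < w -> `|smooth w L x| <= B.
Proof.
move=> w0; have k0 := sqrt2pi_gt0 K.
rewrite /smooth normrM ger0_norm ?invr_ge0 ?(ltW k0)// mulrC ler_pdivrMr//.
apply: (le_trans (le_normr_Rintegral measurableT (integrable_find L x w0))).
rewrite -(Rintegral_gauss x w0) -RintegralZl//; last exact: integrable_gauss.
apply: le_Rintegral => //.
- exact: (integrable_norm (integrable_find L x w0)).
- exact: (integrableZl measurableT B (integrable_gauss x w0)).
- move=> a _; rewrite normrM (ger0_norm (gauss_ge0 _ _)) ler_wpM2r ?gauss_ge0//.
  rewrite (le_trans (find_le _ _))// ler_piMr//; by case/andP: (ind01 L a).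
Qed.

(** For |x| <= M, uniform continuity handles the points a with |x - a| <= r and [gauss_tail] handles
    the others. L = M + 1 keeps the former inside the cut-off, as r <= 1. For |x| > M only the
    trivial bound 2 B remains, to be paid for by tightness. *)
Lemma smooth_approx (M e : K) : 0 < e -> exists w L : K, 0 < w /\
  forall x, `|smooth w L x - f x| <= e + 2 * B * \1_[set y | M < `|y|] x.
Proof.
move=> e0; have e2 : 0 < e / 2 by rewrite divr_gt0.
have [r /andP[r0 r1] rP] := continuous_unif_segment M cf e2.
have k0 := sqrt2pi_gt0 K.
have B1 : 0 < B + 1 by rewrite ltr_pwDr.
have s2 : 0 < Num.sqrt 2 :> K by rewrite sqrtr_gt0.
(* The width w is chosen so that the tail contributes e / 2 times B / (B + 1); the shift by 1 covers
   B = 0. *)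
have [w w0 wE] : exists2 w : K, 0 < w &
    2 * B * (4 * w / r ^+ 2) * Num.sqrt 2 = e / 2 * (B / (B + 1)).
  exists ((e / 2) * r ^+ 2 / (8 * (B + 1) * Num.sqrt 2)).
    by rewrite divr_gt0 ?mulr_gt0// exprn_gt0.
  by field; rewrite !gt_eqF.
exists w, (M + 1); split=> // x.
have [Mx|xM] := ltP M `|x|.
  rewrite indicE mem_set// mulr1 (le_trans (ler_normB _ _))// mulr_natl mulr2n.
  by rewrite ler_wpDl ?(ltW e0)// lerD// smooth_le.
rewrite indicE memNset ?mulr0 ?addr0/=; last by apply/negP; rewrite -leNgt.
have w20 : 0 < 2 * w by rewrite mulr_gt0.
have -> : smooth w (M + 1) x - f x = (Num.sqrt (pi *+ 2))^-1 *
    (\int[leb]_a (f a * ind (M + 1) a * gauss w (a - x)) -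
     \int[leb]_a (f x * gauss w (a - x))).
  rewrite RintegralZl ?Rintegral_gauss//; last exact: integrable_gauss.
  by rewrite /smooth; field; rewrite gt_eqF.
rewrite normrM ger0_norm ?invr_ge0 ?(ltW k0)// mulrC ler_pdivrMr//.
have [c c0 cE] : exists2 c : K, 0 <= c & c = 2 * B * (4 * w / r ^+ 2) * Num.sqrt 2.
  exists (2 * B * (4 * w / r ^+ 2) * Num.sqrt 2) => //.
  by rewrite !mulr_ge0 ?sqrtr_ge0 ?invr_ge0 ?exprn_ge0 ?(ltW w0) ?(ltW r0).
have ih1 := integrableZl measurableT (e / 2) (integrable_gauss x w0).
have ih2 := integrableZl measurableT c (integrable_gauss x w20).
have ih : leb.-integrable setT (EFin \o (fun a =>
    e / 2 * gauss w (a - x) + c * gauss (2 * w) (a - x))).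
  exact: (integrableD measurableT ih1 ih2).
have := Rintegral_dist (integrable_find (M + 1) x w0)
  (integrableZl measurableT (f x) (integrable_gauss x w0)) ih.
rewrite RintegralD// !RintegralZl ?Rintegral_gauss//; try exact: integrable_gauss.
move=> /(_ _)/le_trans; apply.
  move=> a /=; rewrite -mulrBl normrM (ger0_norm (gauss_ge0 _ _)).
  have [xar|rxa] := leP `|x - a| r.
    rewrite ler_wpDr ?mulr_ge0 ?gauss_ge0// ler_wpM2r ?gauss_ge0//.
    rewrite /ind indicE mem_set ?mulr1.
      by rewrite distrC rP.
    rewrite /= in_itv/= -ler_norml.
    rewrite (_ : a = x - (x - a)); last by ring.
    by rewrite (le_trans (ler_normB _ _))// lerD// (le_trans xar).
  rewrite ler_wpDl ?(mulr_ge0 (ltW e2)) ?gauss_ge0//.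
  have gt : gauss w (a - x) <= 4 * w / r ^+ 2 * (Num.sqrt 2 * gauss (2 * w) (a - x)).
    by apply: gauss_tail => //; rewrite distrC ltW.
  apply: (@le_trans _ _ (2 * B * gauss w (a - x))).
    rewrite ler_wpM2r ?gauss_ge0// (le_trans (ler_normB _ _))// mulr_natl mulr2n.
    by rewrite lerD// (le_trans (find_le _ _))// ler_piMr//; case/andP: (ind01 (M + 1) a).
  apply: (le_trans (ler_wpM2l (mulr_ge0 _ B0) gt)) => //.
  by rewrite cE !mulrA.
rewrite -mulrDl ler_wpM2r ?(ltW k0)// [leRHS]splitr lerD2l cE wE.
by rewrite ler_piMr ?(ltW e2)// ler_pdivrMr// mul1r lerDl.
Qed.

Section smooth_expectation.
Context d (T : measurableType d) (P : probability T K) (X : T -> K).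
Hypothesis mX : measurable_fun setT X.
Variables (w L : K).
Hypothesis w0 : 0 < w.

Let gauss_cst_bound : exists2 C : K, 0 <= C & forall u, gauss w u <= C.
Proof.
have [C C0 HC] := gauss_bounds w0; exists C => // u.
by have [] := HC w u (lexx _).
Qed.

Lemma measurable_gauss_rv a : measurable_fun setT (fun t => gauss w (a - X t)).
Proof.
apply: (measurableT_comp (measurable_gauss w)).
exact: measurable_funB.
Qed.

Lemma integrable_gauss_rv a :
  P.-integrable setT (EFin \o (fun t => gauss w (a - X t))).
Proof.
have [C C0 HC] := gauss_cst_bound.
apply: (@bounded_integrable _ _ _ P _ C (measurable_gauss_rv a)) => t.
by rewrite ger0_norm ?gauss_ge0.
Qed.

Let F (z : T * K) := (f z.2 * ind L z.2 * gauss w (z.2 - X z.1))%:E.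

Let iF : (P \x leb)%E.-integrable setT F.
Proof.
have [C C0 HC] := gauss_cst_bound.
have mF : measurable_fun setT F.
  apply/measurable_EFinP; apply: measurable_funM.
    exact: (measurableT_comp (measurable_find L)).
  apply: (measurableT_comp (measurable_gauss w)); apply: measurable_funB => //.
  exact: measurableT_comp.
apply/integrable12ltyP => //.
apply: (@le_lt_trans _ _ (\int[P]_t (B * Num.sqrt (pi *+ 2))%:E)%E).
  apply: ge0_le_integral => //.
  - by move=> t _; apply: integral_ge0.
  - have mnF : measurable_fun setT (abse \o F) by exact: measurableT_comp.
    have := @measurable_fun_fubini_tonelli_F _ _ _ _ K leb (abse \o F) mnF.
    by rewrite /fubini_F/=; apply.
  - move=> t _; rewrite -(Rintegral_gauss (X t) w0) -RintegralZl//; last first.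
      exact: integrable_gauss.
    rewrite EFin_Rintegral; last first.
      exact: (integrableZl measurableT B (integrable_gauss (X t) w0)).
    apply: ge0_le_integral => //.
    - apply: measurableT_comp => //.
      exact: measurable_int (integrable_find L (X t) w0).
    - apply/measurable_EFinP; apply: measurable_funM => //; exact: measurable_gauss_shift.
    - move=> a _; rewrite lee_fin normrM (ger0_norm (gauss_ge0 _ _)) ler_wpM2r ?gauss_ge0//.
      rewrite (le_trans (find_le _ _))// ler_piMr//; by case/andP: (ind01 L a).
by rewrite integral_cst// [X in (_ * X)%E]probability_setT mule1 ltry.
Qed.

Let inner t :
  (\int[leb]_a (f a * ind L a * gauss w (a - X t)))%:E = (\int[leb]_a F (t, a))%E.
Proof. by rewrite EFin_Rintegral//; exact: integrable_find. Qed.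

Let integrable_inner : P.-integrable setT
  (EFin \o (fun t => \int[leb]_a (f a * ind L a * gauss w (a - X t)))).
Proof.
rewrite [X in _.-integrable _ X](_ : _ = fubini_F leb F).
  exact: integrable_fubini_F.
by apply/funext => t /=; rewrite inner.
Qed.

Lemma integrable_smooth : P.-integrable setT (EFin \o (smooth w L \o X)).
Proof. exact: (integrableZl measurableT _ integrable_inner). Qed.

(** Fubini exposes the kernel expectations, the only quantities whose convergence will be
    assumed. *)
Lemma Rintegral_smooth :
  \int[P]_t smooth w L (X t) = (Num.sqrt (pi *+ 2))^-1 *
    \int[leb]_a (f a * ind L a * \int[P]_t gauss w (a - X t)).
Proof.
rewrite RintegralZl//; congr (_ * _).
rewrite {1}/Rintegral [X in fine X](_ : _ = \int[P]_t \int[leb]_a F (t, a))%E; last first.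
  by apply: eq_integral => t _; rewrite inner.
rewrite Fubini// [RHS]/Rintegral; congr fine; apply: eq_integral => a _.
rewrite -RintegralZl//; last exact: integrable_gauss_rv.
by rewrite EFin_Rintegral//; exact: (integrableZl measurableT _ (integrable_gauss_rv a)).
Qed.

End smooth_expectation.
End smoothing.

Lemma Rintegral_dominated_cvg d (T : measurableType d) (K : realType)
    (mu : {measure set T -> \bar K}) (f_ : nat -> T -> K) (f g : T -> K) :
  (forall n, measurable_fun setT (f_ n)) -> measurable_fun setT f ->
  (forall x, f_ n x @[n --> \oo] --> f x) ->
  mu.-integrable setT (EFin \o g) -> (forall n x, `|f_ n x| <= g x) ->
  \int[mu]_x f_ n x @[n --> \oo] --> \int[mu]_x f x.
Proof.
move=> mf_ mf f_f ig f_g.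
have cvE x : [set: T] x -> ((f_ n x)%:E @[n --> \oo] --> (f x)%:E)%E.
  by move=> _; apply: cvg_EFin; [exact: nearW|exact: f_f].
have [if_ _ cv] := @dominated_convergence _ T K mu setT measurableT
  (fun n x => (f_ n x)%:E) (EFin \o f) (EFin \o g)
  (fun n => (measurable_EFinP _ _).2 (mf_ n)) ((measurable_EFinP _ _).2 mf)
  (aeW _ cvE) ig
  (aeW _ (fun x n _ => f_g n x)).
apply: fine_cvg; rewrite fineK//; exact: (integrable_fin_num measurableT if_).
Qed.

Lemma measurable_tail (K : realType) (M : K) : measurable [set y : K | M < `|y|].
Proof.
have -> : [set y : K | M < `|y|] = setT `&` Num.norm @^-1` `]M, +oo[.
  by apply/seteqP; split=> x /=; rewrite in_itv/= andbT; tauto.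
exact: normr_measurable.
Qed.

(** Dominated convergence along integer thresholds, then monotonicity in the threshold. It is used
    with g = 1 for the tightness of the limit law and with g = (R^2 - 1)^2 for Lindeberg's
    condition. *)
Lemma Rintegral_tail d (T : measurableType d) (K : realType)
    (mu : {measure set T -> \bar K}) (g Y : T -> K) (e : K) :
  measurable_fun setT Y -> mu.-integrable setT (EFin \o g) -> (forall x, 0 <= g x) ->
  0 < e -> exists2 M : K, 0 < M &
    forall M', M <= M' -> \int[mu]_x (g x * \1_[set y | M' < `|y|] (Y x)) <= e.
Proof.
move=> mY ig g0 e0.
have mset := @measurable_tail K.
have mI (M : K) : measurable_fun setT (fun x => \1_[set y : K | M < `|y|] (Y x) : K).
  by apply: measurableT_comp => //; exact: measurable_indic.
have mg : measurable_fun setT g by exact/measurable_EFinP/(measurable_int mu).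
have ind1 (M y : K) : 0 <= (\1_[set y : K | M < `|y|] y : K) <= 1.
  by rewrite indicE; case: (_ \in _); rewrite ?ler01 ?lexx.
have ile (M : K) x : `|g x * \1_[set y | M < `|y|] (Y x)| <= g x.
  have /andP[i0 i1] := ind1 M (Y x).
  by rewrite ger0_norm ?mulr_ge0// ler_piMr.
have ii (M : K) : mu.-integrable setT (EFin \o (fun x => g x * \1_[set y | M < `|y|] (Y x))).
  by apply: (integrable_dominated (g := g)) => //; exact: measurable_funM.
have cv : \int[mu]_x (g x * \1_[set y | n%:R < `|y|] (Y x)) @[n --> \oo] -->
    \int[mu]_x (fun=> 0 : K) x.
  apply: (@Rintegral_dominated_cvg _ _ _ _ _ _ g) => // [n|x].
    exact: measurable_funM.
  apply: cvg_near_cst; near=> n.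
  rewrite indicE memNset ?mulr0//=; apply/negP; rewrite -leNgt.
  by near: n; exact: nbhs_infty_ger.
rewrite /Rintegral integral0 /= in cv.
have /cvgrPdist_le/(_ _ e0)[N _ NP] := cv.
exists N.+1%:R; first by rewrite ltr0n.
move=> M' NM'; have := NP N (leqnn N).
rewrite sub0r normrN => /(le_trans (ler_norm _)) => /(le_trans _); apply.
apply: le_Rintegral => // x _; rewrite ler_wpM2l// !indicE ler_nat.
case: (boolP (_ \in _)) => //; rewrite inE/= => MY.
rewrite mem_set//= (le_lt_trans _ MY)// (le_trans _ NM')// ler_nat.
exact: leqnSn.
Unshelve. all: by end_near. Qed.

Lemma measurable_gauss_mean d (T : measurableType d) (K : realType)
    (P : probability T K) (X : T -> K) (w : K) : measurable_fun setT X ->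
  measurable_fun setT (fun a : K => \int[P]_t gauss w (a - X t)).
Proof.
move=> mX; pose F (z : T * measurableTypeR K) := (gauss w (z.2 - X z.1))%:E.
have mF : measurable_fun setT F.
  apply/measurable_EFinP; apply: (measurableT_comp (measurable_gauss w)).
  by apply: measurable_funB => //; exact: measurableT_comp.
have := @measurable_fun_fubini_tonelli_G _ _ _ _ K P F mF.
move=> /(_ (fun z => gauss_ge0 _ _)) mG.
exact: (measurableT_comp (@fine_measurable K setT measurableT) mG).
Qed.

Section weak_convergence.
Variables (K : realType) (dO : measure_display) (Omega : measurableType dO).
Variable P : probability Omega K.

(** The kernels suffice because [smooth f w L] is an average of them over a and is uniformly close
    to f on [-M, M]; tightness of [X d] and of [mu] makes the mass outside negligible. *)
Lemma gauss_cvg_in_law (X : nat -> Omega -> K)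
    (mu : probability (measurableTypeR K) K) :
  (forall d, measurable_fun setT (X d)) ->
  (forall e : K, 0 < e -> exists M, \forall d \near \oo,
     \int[P]_t \1_[set y | M < `|y|] (X d t) <= e) ->
  (forall w a : K, 0 < w -> \int[P]_t gauss w (a - X d t) @[d --> \oo] -->
     \int[mu]_x gauss w (a - x)) ->
  cvg_in_law P X mu.
Proof.
move=> mX tX cvX f cf [B0 [_ fB0]].
pose B := `|B0| + 1.
have fB x : `|f x| <= B by apply: fB0 => //; rewrite /B ltr_pwDr// ler_norm.
have B_ge0 : 0 <= B by rewrite addr_ge0.
have mf : measurable_fun setT f by exact: continuous_measurable_fun.
have ifX d : P.-integrable setT (EFin \o (f \o X d)).
  exact: (@bounded_integrable _ _ _ P _ B (measurableT_comp mf (mX d)) (fun t => fB _)).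
have ifmu : mu.-integrable setT (EFin \o f).
  exact: (@bounded_integrable _ _ _ mu _ B).
rewrite (_ : (fun d => _) = (fun d => (\int[P]_t f (X d t))%:E)); last first.
  by apply/funext => d; rewrite (EFin_Rintegral (ifX d)) unlock.
rewrite -EFin_Rintegral//; apply: cvg_EFin; first exact: nearW.
apply/cvgrPdist_le => e e0 /=.
(* Five shares: two for smoothing under the law of [X d], two for smoothing under [mu], and one for
   the convergence of the smoothed integrals. *)
pose h := e / 5; have h0 : 0 < h by rewrite divr_gt0.
pose tau := h / (2 * B + 1).
have B1 : 0 < 2 * B + 1 by rewrite ltr_wpDl// mulr_ge0.
have tau0 : 0 < tau by rewrite divr_gt0.
have Btau : 2 * B * tau <= h.
  by rewrite /tau mulrCA ler_piMr ?(ltW h0)// ler_pdivrMr// mul1r lerDl.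
have [M1 tM1] := tX _ tau0.
have [M2 M20 tM2] := @Rintegral_tail _ _ K mu (cst 1) id tau (@measurable_id _ _ _)
  (integrable_cstT mu 1) (fun _ => ler01) tau0.
pose M := Num.max M1 M2.
have [w [L [w0 sP]]] := smooth_approx cf fB M h0.
have mset := @measurable_tail K.
have key (d' : measure_display) (T : measurableType d') (Q : probability T K) (Y : T -> K) (M' : K) :
    measurable_fun setT Y -> M' <= M ->
    \int[Q]_t \1_[set y | M' < `|y|] (Y t) <= tau ->
    `|\int[Q]_t smooth f w L (Y t) - \int[Q]_t f (Y t)| <= 2 * h.
  move=> mY M'M tail.
  have iI (N : K) : Q.-integrable setT (EFin \o (fun t => \1_[set y | N < `|y|] (Y t))).
    apply: (@bounded_integrable _ _ _ Q _ 1).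
      by apply: (measurableT_comp (measurable_indic (mset _))).
    by move=> t; rewrite indicE ger0_norm//; case: (_ \in _).
  have iB := integrableZl measurableT (2 * B) (iI M).
  have ih : Q.-integrable setT (EFin \o (fun t => h + 2 * B * \1_[set y | M < `|y|] (Y t))).
    exact: (integrableD measurableT (integrable_cstT Q h) iB).
  have ifY : Q.-integrable setT (EFin \o (f \o Y)).
    exact: (@bounded_integrable _ _ _ Q _ B (measurableT_comp mf mY) (fun t => fB _)).
  apply: (le_trans (Rintegral_dist (integrable_smooth cf fB Q mY L w0) ifY ih _)).
    by move=> t; exact: sP.
  rewrite RintegralD//; last exact: integrable_cstT.
  rewrite Rintegral_cstT RintegralZl// [leRHS]mulr_natl mulr2n lerD2l (le_trans _ Btau)//.
  rewrite ler_wpM2l ?mulr_ge0// (le_trans _ tail)//.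
  apply: le_Rintegral => // t _; rewrite !indicE ler_nat.
  case: (boolP (_ \in _)) => //; rewrite inE/= => MY.
  by rewrite mem_set//= (le_lt_trans _ MY).
have smu : `|\int[mu]_x smooth f w L x - \int[mu]_x f x| <= 2 * h.
  apply: (key _ _ mu id M2) => //; first by rewrite le_max lexx orbT.
  by have := tM2 _ (lexx M2); under eq_Rintegral do rewrite mul1r.
(* Convergence of the kernel expectations is known for each a separately; boundedness of the kernel
   and the cut-off carry it through the integral over a. *)
have scv : \int[P]_t smooth f w L (X d t) @[d --> \oo] --> \int[mu]_x smooth f w L x.
  have mid : measurable_fun setT (@idfun (measurableTypeR K)) by exact: measurable_id.
  rewrite (Rintegral_smooth cf fB mu mid L w0).
  under eq_fun do rewrite (Rintegral_smooth cf fB P (mX _) L w0).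
  apply: cvgMl_tmp.
  have [C C0 HC] := gauss_bounds w0.
  have gC u : `|gauss w u| <= C.
    by rewrite ger0_norm ?gauss_ge0//; have [] := HC w u (lexx _).
  have EC (d' : measure_display) (T : measurableType d') (Q : probability T K) (Y : T -> K) a :
      measurable_fun setT Y -> `|\int[Q]_t gauss w (a - Y t)| <= C.
    move=> mY; have ig := integrable_gauss_rv Q mY w0 a.
    apply: (le_trans (le_normr_Rintegral measurableT ig)).
    rewrite -[leRHS](Rintegral_cstT Q); apply: le_Rintegral => //.
      exact: (integrable_norm ig).
    exact: integrable_cstT.
  apply: (@Rintegral_dominated_cvg _ _ K (@lebesgue_measure K)
    (fun d a => f a * \1_`[- L, L] a * \int[P]_t gauss w (a - X d t))
    (fun a => f a * \1_`[- L, L] a * \int[mu]_x gauss w (a - x)) (fun a => C * B * \1_`[- L, L] a)).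
  - move=> d; apply: measurable_funM; last exact: measurable_gauss_mean.
    by apply: measurable_funM => //; exact: measurable_indic.
  - apply: measurable_funM; last exact: measurable_gauss_mean.
    by apply: measurable_funM => //; exact: measurable_indic.
  - by move=> a; apply: cvgMl_tmp; exact: cvX.
  - exact: (integrableZl measurableT (C * B) (integrable_indic_itv (- L) L true false)).
  - move=> d a; rewrite normrM mulrC -mulrA ler_pM//; first exact: EC.
    rewrite normrM ler_pM// indicE ger0_norm//.
have h1 : \forall d \near \oo, `|\int[P]_t smooth f w L (X d t) - \int[mu]_x smooth f w L x| <= h.
  by move/cvgrPdist_le : scv => /(_ _ h0); under eq_near do rewrite distrC.
near=> d.
have a1 : `|\int[P]_t smooth f w L (X d t) - \int[P]_t f (X d t)| <= 2 * h.
  apply: (key _ _ P (X d) M1) => //; first by rewrite le_max lexx.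
  by near: d.
have a2 : `|\int[P]_t smooth f w L (X d t) - \int[mu]_x smooth f w L x| <= h.
  by near: d.
have eh : e = 5 * h by rewrite /h; field.
move: a1 a2 smu; rewrite !ler_norml; lra.
Unshelve. all: by end_near. Qed.
End weak_convergence.

(** [normal_pdf] is almost everywhere the Radon-Nikodym derivative of [normal_prob], since both have
    the same integral over every measurable set; change of variables then applies. *)
Lemma Rintegral_normal_prob (K : realType) (m s B : K) (f : K -> K) :
  measurable_fun setT f -> (forall x, `|f x| <= B) ->
  \int[normal_prob m s]_x f x = \int[@lebesgue_measure K]_x (f x * normal_pdf m s x).
Proof.
move=> mf fB.
have if_ : (normal_prob m s).-integrable setT (EFin \o f).
  exact: (@bounded_integrable _ _ _ (normal_prob m s) f B mf fB).
have dom := normal_prob_dominates m s.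
have iRN : (@lebesgue_measure K).-integrable setT
    (Radon_Nikodym (charge_of_finite_measure (normal_prob m s)) (@lebesgue_measure K)).
  exact: Radon_Nikodym_integrable.
rewrite /Rintegral -(Radon_Nikodym_change_of_variables dom measurableT if_); congr fine.
apply: ae_eq_integral => //.
- by apply: emeasurable_funM; [exact/measurable_EFinP|exact: measurable_int iRN].
- apply/measurable_EFinP; apply: measurable_funM => //; exact: measurable_normal_pdf.
- rewrite [X in ae_eq _ _ _ X](_ : _ = (EFin \o f) \* (EFin \o normal_pdf m s))%E//.
  apply: ae_eqe_mul2l; apply: integral_ae_eq => //.
  + by apply/measurable_EFinP; exact: measurable_normal_pdf.
  + by move=> E _ mE; rewrite -Radon_Nikodym_integral.
Qed.

(* Completing the square. *)
Lemma gauss_mul (K : realType) (w v a x : K) : 0 < w -> 0 < v ->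
  gauss w (a - x) * gauss v x =
  gauss (w + v) a * gauss (w * v / (w + v)) (x - a * v / (w + v)).
Proof.
move=> w0 v0; have wv0 : 0 < w + v by rewrite addr_gt0.
rewrite /gauss -!expRD; congr expR.
rewrite lnM ?posrE ?mulr_gt0// ?invr_gt0// lnM ?posrE// lnV ?posrE//.
by field; rewrite !gt_eqF.
Qed.

(** After completing the square, the integral over x is the total mass of one kernel, which cancels
    the normalization. For v = 0 the measure is the point mass and the integral is an evaluation. *)
Lemma Rintegral_gauss_normal (K : realType) (w v a : K) : 0 < w -> 0 <= v ->
  \int[centered_normal v]_x gauss w (a - x) = gauss (w + v) a.
Proof.
move=> w0 v0; rewrite /centered_normal; case: eqP => [->|/eqP vn0].
  rewrite /Rintegral integral_dirac//=.
    by rewrite indicT mul1r subr0 addr0.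
  apply/measurable_EFinP; apply: (measurableT_comp (measurable_gauss w)).
  exact: measurable_funB.
have vp : 0 < v by rewrite lt_def vn0.
have wv0 : 0 < w + v by rewrite addr_gt0.
have [C C0 HC] := gauss_bounds w0.
rewrite [LHS](@Rintegral_normal_prob K 0 (Num.sqrt v) C (fun x => gauss w (a - x))).
- under eq_Rintegral do rewrite normal_pdf_gauss// subr0 mulrCA gauss_mul//.
  have z0 : 0 < w * v / (w + v) by rewrite divr_gt0 ?mulr_gt0.
  rewrite RintegralZl//; last first.
    exact: (integrableZl measurableT _ (integrable_gauss _ z0)).
  rewrite RintegralZl ?Rintegral_gauss//; last exact: integrable_gauss.
  by rewrite mulrCA mulVf ?mulr1// gt_eqF// sqrt2pi_gt0.
- apply: (measurableT_comp (measurable_gauss w)); exact: measurable_funB.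
- by move=> x; rewrite ger0_norm ?gauss_ge0//; have [] := HC w (a - x) (lexx _).
Qed.

(** * Independence of the past and the next step *)

Section product_rule.
Variables (K : realType) (dO : measure_display) (Omega : measurableType dO).
Variable P : probability Omega K.

Definition indep_rv (X Y : Omega -> K) := forall A B : set K,
  measurable A -> measurable B ->
  P (X @^-1` A `&` Y @^-1` B) = (P (X @^-1` A) * P (Y @^-1` B))%E.

Variables X Y : Omega -> K.
Hypotheses (mX : measurable_fun setT X) (mY : measurable_fun setT Y).
Hypotheses (iX : P.-integrable setT (EFin \o X)) (iY : P.-integrable setT (EFin \o Y)).
Hypothesis XY : indep_rv X Y.

Let X' : {RV P >-> K} := mfun_Sub (mem_set mX).
Let Y' : {RV P >-> K} := mfun_Sub (mem_set mY).
Let Z' : {RV P >-> (K * K)%type} :=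
  mfun_Sub (mem_set (measurable_fun_pair mX mY)).
Let h (z : K * K) := (z.1 * z.2)%:E.

Let mh : measurable_fun setT h.
Proof. by apply/measurable_EFinP; apply: measurable_funM. Qed.

(** Independence is the statement for rectangles, which determine a measure on the plane; the
    product rule then becomes Fubini for [h]. *)
Let lawE (A : set (K * K)) : measurable A ->
  (distribution P X' \x distribution P Y')%E A = distribution P Z' A.
Proof.
apply: product_measure_unique => B C mB mC.
exact: XY.
Qed.

Let iX' : (distribution P X').-integrable setT (EFin \o idfun).
Proof. by apply: integrable_pushforward => //; apply/measurable_EFinP; exact: measurable_id. Qed.

Let iY' : (distribution P Y').-integrable setT (EFin \o idfun).
Proof. by apply: integrable_pushforward => //; apply/measurable_EFinP; exact: measurable_id. Qed.

Let prod_integrable : (distribution P X' \x distribution P Y')%E.-integrable setT h.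
Proof.
apply/integrable12ltyP => //.
rewrite (eq_integral (fun x : K => `|x|%:E * \int[distribution P Y']_(y in [set: K]) `|y : K|%:E)%E); last first.
  move=> x _; rewrite -ge0_integralZl//.
    by apply: eq_integral => y _; rewrite /h/= normrM EFinM.
  by apply/measurable_EFinP; exact: normr_measurable.
have iYn := integrable_norm iY'; have iXn := integrable_norm iX'.
rewrite -(EFin_Rintegral iYn).
have := integrable_fin_num measurableT (integrableZr measurableT (Rintegral (distribution P Y') setT (@Num.norm K K \o idfun)) iXn).
by move=> /fin_numPlt/andP[].
Qed.

Lemma integrable_indepM : P.-integrable setT (EFin \o (X \* Y)).
Proof.
apply/integrableP; split.
  by apply/measurable_EFinP; exact: measurable_funM.
have := (integrableP _ _ _ prod_integrable).2.
rewrite (eq_measure_integral (distribution P Z')) => [|A mA _]; last exact: lawE.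
by rewrite ge0_integral_distribution//; exact: measurableT_comp.
Qed.

Lemma Rintegral_indepM : \int[P]_t (X t * Y t) = \int[P]_t X t * \int[P]_t Y t.
Proof.
apply: EFin_inj; rewrite (EFin_Rintegral integrable_indepM) EFinM.
transitivity (\int[P]_t (h \o Z') t)%E; first by [].
rewrite -integral_distribution//; last exact: integrable_indepM.
rewrite -(eq_measure_integral _ (fun A mA _ => lawE mA)).
rewrite -(integral12_prod_meas1 prod_integrable) /fubini_F.
rewrite (eq_integral (fun x : K => x%:E * \int[distribution P Y']_(y in [set: K]) (y : K)%:E)%E); last first.
  move=> x _; rewrite -integralZl//.
rewrite -(EFin_Rintegral iY') integralZr//; congr (_ * _)%E.
  by rewrite integral_distribution// EFin_Rintegral.
rewrite (EFin_Rintegral iY') (EFin_Rintegral iY) integral_distribution//.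
by apply/measurable_EFinP; exact: measurable_id.
Qed.

End product_rule.

(** As functions of E, both sides are finite measures, P restricted to H and P scaled by P(H); they
    agree on a pi-system, hence on the sigma-algebra it generates. *)
Lemma indep_sigma (K : realType) (dO : measure_display) (Omega : measurableType dO)
    (P : probability Omega K) (G : set_system Omega) (H : set Omega) :
  setI_closed G -> G `<=` measurable -> G setT -> measurable H ->
  (forall E, G E -> P (E `&` H) = (P E * P H)%E) ->
  forall E, <<s G >> E -> P (E `&` H) = (P E * P H)%E.
Proof.
move=> GI Gm GT mH GH E sE.
have PHfin : P H \is a fin_num by exact: fin_num_measure.
have p0 : 0 <= fine (P H) by exact: fine_ge0.
have -> : (P E * P H)%E = mscale (NngNum p0) P E.
  by rewrite /mscale/= fineK// muleC.
apply: (@g_sigma_algebra_measure_unique _ K _ G Gm (fun=> setT) (fun=> GT) _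
  (mrestr P mH) (mscale (NngNum p0) P)) => //.
- by apply/seteqP; split=> // x _; exists 0%N.
- by move=> A GA; rewrite /mrestr /mscale/= [LHS](GH _ GA) muleC; congr (_ * _)%E; rewrite fineK.
- move=> _; have mTH : measurable (setT `&` H) by exact: measurableI.
  exact: (le_lt_trans (probability_le1 P mTH) (ltry _)).
Qed.

Lemma prod_iota_fset (K : realType) (a : nat) (F : nat -> \bar K) :
  (\prod_(i <- [fset i in iota 0 a]%fset) F i = \prod_(i < a) F i)%E.
Proof.
rewrite (perm_big (iota 0 a)) /=.
  by rewrite -[X in iota 0 X]subn0 -/(index_iota 0 a) big_mkord.
apply: uniq_perm; [exact: fset_uniq|exact: iota_uniq|].
by move=> i; rewrite !inE.
Qed.

Lemma set_iota_fset (a : nat) : [set` [fset i in iota 0 a]%fset] = `I_a.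
Proof. by apply/seteqP; split=> i /=; rewrite !inE/= mem_iota. Qed.

Section past.
Variables (K : realType) (dO : measure_display) (Omega : measurableType dO).
Variables (P : probability Omega K) (d : nat).
Variables (Ri : nat -> {RV P >-> K}) (V : nat -> {RV P >-> borel_rV K d}).
Hypothesis Ri_indep : independent_seq P Ri.
Hypothesis V_indep : independent_seq P V.
Hypothesis RV_indep : independent2 P (sigma_seq Ri) (sigma_seq V).

Let capR a (A : nat -> set K) := \bigcap_(i < a) (Ri i @^-1` A i).
Let capV b (B : nat -> set (borel_rV K d)) := \bigcap_(i < b) (V i @^-1` B i).

Let capRT a : capR a (fun=> setT) = setT. Proof. by apply/seteqP; split. Qed.

Let capVT b : capV b (fun=> setT) = setT. Proof. by apply/seteqP; split. Qed.

(* Events on the radii R_0, ..., R_(a-1) and the directions V_0, ..., V_(b-1);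
   keeping [a] and [b] apart lets one add V_k to the past before R_k. *)
Definition cylinder (a b : nat) : set_system Omega :=
  [set E | exists A B, [/\ forall i, measurable (A i), forall i, measurable (B i) &
     E = capR a A `&` capV b B]].

Let mRi i (A : set K) : measurable A -> measurable (Ri i @^-1` A).
Proof. by move=> mA; rewrite -[X in measurable X]setTI; exact: measurable_funPT. Qed.

Let mV i (B : set (borel_rV K d)) : measurable B -> measurable (V i @^-1` B).
Proof. by move=> mB; rewrite -[X in measurable X]setTI; exact: measurable_funPT. Qed.

Lemma cylinder_measurable a b : cylinder a b `<=` measurable.
Proof.
move=> _ [A [B [mA mB ->]]]; apply: measurableI.
  by apply: bigcap_measurableType => i _; exact: mRi.
by apply: bigcap_measurableType => i _; exact: mV.
Qed.

Lemma cylinderI a b : setI_closed (cylinder a b).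
Proof.
move=> _ _ [A [B [mA mB ->]]] [A' [B' [mA' mB' ->]]].
exists (fun i => A i `&` A' i), (fun i => B i `&` B' i); split.
- by move=> i; exact: measurableI.
- by move=> i; exact: measurableI.
- by rewrite setIACA /capR /capV -!bigcapI.
Qed.

Lemma cylinderT a b : cylinder a b setT.
Proof.
exists (fun=> setT), (fun=> setT); split => //.
by rewrite capRT capVT setIT.
Qed.

Lemma cylinderE a b A B : (forall i, measurable (A i)) -> (forall i, measurable (B i)) ->
  P (capR a A `&` capV b B) =
  (\prod_(i < a) P (Ri i @^-1` A i) * \prod_(i < b) P (V i @^-1` B i))%E.
Proof.
move=> mA mB.
have sR : sigma_seq Ri (capR a A).
  apply: (@bigcap_measurableType _ (g_sigma_algebraType (\bigcup_i sigma_rv (Ri i)))) => i _.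
  apply: sub_sigma_algebra; exists i => //; exists (A i) => //.
  by rewrite setTI.
have sV : sigma_seq V (capV b B).
  apply: (@bigcap_measurableType _ (g_sigma_algebraType (\bigcup_i sigma_rv (V i)))) => i _.
  apply: sub_sigma_algebra; exists i => //; exists (B i) => //.
  by rewrite setTI.
rewrite RV_indep//; congr (_ * _)%E.
- rewrite -(prod_iota_fset a (fun i => P (Ri i @^-1` A i))) -Ri_indep.
    by rewrite set_iota_fset.
  by move=> i _; exists (A i) => //; rewrite setTI.
- rewrite -(prod_iota_fset b (fun i => P (V i @^-1` B i))) -V_indep.
    by rewrite set_iota_fset.
  by move=> i _; exists (B i) => //; rewrite setTI.
Qed.

(** A cylinder intersected with an event on [Ri a] is a cylinder with one more radius, so
    [cylinderE] gives the product formula on the pi-system of cylinders and [indep_sigma] extends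
    it. *)
Lemma cylinder_indepR a b (E : set Omega) (C : set K) : <<s cylinder a b >> E ->
  measurable C -> P (E `&` Ri a @^-1` C) = (P E * P (Ri a @^-1` C))%E.
Proof.
move=> sE mC; apply: (indep_sigma (@cylinderI a b) (@cylinder_measurable a b)
  (@cylinderT a b) (mRi a mC)) sE => _ [A [B [mA mB ->]]].
pose A' i := if i == a then C else A i.
have -> : capR a A `&` capV b B `&` Ri a @^-1` C = capR a.+1 A' `&` capV b B.
  rewrite setIAC; congr (_ `&` _); rewrite /capR !bigcap_mkord big_ord_recr/= /A' eqxx.
  by congr (_ `&` _); apply: eq_bigr => i _; rewrite ltn_eqF.
rewrite cylinderE//; last by move=> i; rewrite /A'; case: ifP.
rewrite cylinderE// big_ord_recr/= /A' eqxx muleAC; congr (_ * _ * _)%E.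
by apply: eq_bigr => i _; rewrite ltn_eqF.
Qed.

Lemma cylinder_indepV a b (E : set Omega) (C : set (borel_rV K d)) : <<s cylinder a b >> E ->
  measurable C -> P (E `&` V b @^-1` C) = (P E * P (V b @^-1` C))%E.
Proof.
move=> sE mC; apply: (indep_sigma (@cylinderI a b) (@cylinder_measurable a b)
  (@cylinderT a b) (mV b mC)) sE => _ [A [B [mA mB ->]]].
pose B' i := if i == b then C else B i.
have -> : capR a A `&` capV b B `&` V b @^-1` C = capR a A `&` capV b.+1 B'.
  rewrite -setIA; congr (_ `&` _); rewrite /capV !bigcap_mkord big_ord_recr/= /B' eqxx.
  by congr (_ `&` _); apply: eq_bigr => i _; rewrite ltn_eqF.
rewrite cylinderE//; last by move=> i; rewrite /B'; case: ifP.
rewrite cylinderE// big_ord_recr/= /B' eqxx muleA; congr (_ * _ * _)%E.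
by apply: eq_bigr => i _; rewrite ltn_eqF.
Qed.

(** Adaptedness to the first a radii and b directions. Testing against such X replaces conditioning
    on the past. *)
Definition past (a b : nat) (X : Omega -> K) :=
  measurable_fun (setT : set (g_sigma_algebraType (cylinder a b))) X.

Lemma past_measurable a b X : past a b X -> measurable_fun setT X.
Proof.
move=> pX _ C mC; rewrite setTI.
have := pX measurableT C mC; rewrite setTI.
apply: smallest_sub; first exact: sigma_algebra_measurable.
exact: cylinder_measurable.
Qed.

Lemma past_R a b i : (i < a)%N -> past a b (Ri i).
Proof.
move=> ia _ C mC; rewrite setTI; apply: sub_sigma_algebra.
exists (fun j => if j == i then C else setT), (fun=> setT); split => //.
  by move=> j; case: ifP.
rewrite -/(capR _ _) -/(capV _ _) capVT setIT; apply/seteqP; split=> t /=.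
  by move=> Ct j /= ja; case: eqP => [->|].
by move=> /(_ i ia); rewrite /= eqxx.
Qed.

Lemma past_V a b i (C : set (borel_rV K d)) : (i < b)%N -> measurable C ->
  past a b (\1_(V i @^-1` C)).
Proof.
move=> ib mC; apply: measurable_indic; apply: sub_sigma_algebra.
exists (fun=> setT), (fun j => if j == i then C else setT); split => //.
  by move=> j; case: ifP.
rewrite -/(capR _ _) -/(capV _ _) capRT setTI; apply/seteqP; split=> t /=.
  by move=> Ct j /= ja; case: eqP => [->|].
by move=> /(_ i ib); rewrite /= eqxx.
Qed.

Lemma past_indepR a b X (h : K -> K) : past a b X -> measurable_fun setT h ->
  indep_rv P X (h \o Ri a).
Proof.
move=> pX mh A B mA mB; apply: (@cylinder_indepR a b _ (h @^-1` B)).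
  by have := pX measurableT A mA; rewrite setTI.
by rewrite -[X in measurable X]setTI; exact: mh.
Qed.

Lemma past_indepV a b X (C : set (borel_rV K d)) : past a b X -> measurable C ->
  indep_rv P X (\1_(V b @^-1` C)).
Proof.
move=> pX mC A B mA mB.
have -> : \1_(V b @^-1` C) @^-1` B = V b @^-1` (\1_C @^-1` B :> set (borel_rV K d)).
  by apply/seteqP; split=> t /=; rewrite !indicE.
apply: (@cylinder_indepV a b); first by have := pX measurableT A mA; rewrite setTI.
by rewrite -[X in measurable X]setTI; apply: measurable_indic.
Qed.

End past.

Lemma Rintegral_sum d (T : measurableType d) (K : realType) (mu : {measure set T -> \bar K})
    (I : Type) (r : seq I) (F : I -> T -> K) :
  (forall i, mu.-integrable setT (EFin \o F i)) ->
  mu.-integrable setT (EFin \o (fun t => \sum_(i <- r) F i t)) /\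
  \int[mu]_t (\sum_(i <- r) F i t) = \sum_(i <- r) \int[mu]_t F i t.
Proof.
move=> iF; elim: r => [|i r [ir IH]].
  have -> : (fun t => \sum_(i <- [::]) F i t) = cst 0.
    by apply/funext => t; rewrite big_nil.
  by rewrite big_nil; split; [exact: integrable0|rewrite /Rintegral integral0].
have -> : (fun t => \sum_(j <- i :: r) F j t) = (fun t => F i t + \sum_(j <- r) F j t).
  by apply/funext => t; rewrite big_cons.
split; first exact: (integrableD measurableT (iF i) ir).
by rewrite big_cons -IH RintegralD.
Qed.

(** * Basis vectors as labels in ['I_d] *)

Section labels.
Variables (K : realType) (d' : nat).
Let d := d'.+1.

Lemma borel_rV_set1 (v : 'rV[K]_d) : measurable ([set v] : set (borel_rV K d)).
Proof.
rewrite -[X in measurable X]setCK; apply: measurableC; apply: sub_sigma_algebra.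
apply: closed_openC; apply: accessible_closed_set1.
exact/hausdorff_accessible/norm_hausdorff.
Qed.

(* Vectors outside the standard basis, which have probability 0, get the junk
   label [ord0], so that every vector has exactly one label. *)
Definition label (v : borel_rV K d) : 'I_d :=
  odflt ord0 [pick j | (v : 'rV[K]_d) == delta_mx 0 j].

Lemma label_delta j : label (delta_mx 0 j) = j.
Proof.
rewrite /label; case: pickP => [i /eqP/matrixP/(_ 0 i)|/(_ j)]; last by rewrite eqxx.
rewrite !mxE !eqxx/=; case: eqP => [->//|_] /eqP.
by rewrite eq_sym oner_eq0.
Qed.

Definition basis : set (borel_rV K d) := \bigcup_(j in [set: 'I_d]) [set delta_mx 0 j].

Lemma basis_measurable : measurable basis.
Proof.
apply: fin_bigcup_measurable; first exact: finite_finset.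
by move=> j _; exact: borel_rV_set1.
Qed.

Lemma basisP v : basis v <-> v = delta_mx 0 (label v).
Proof.
split=> [[j _ ->]|->]; first by rewrite label_delta.
by exists (label v).
Qed.

Lemma label_basis j : label @^-1` [set j] `&` basis = [set delta_mx 0 j].
Proof.
apply/seteqP; split=> v /=; first by move=> [<- /basisP].
by move=> ->; split; [rewrite label_delta|exists j].
Qed.

Lemma label_measurable j : measurable (label @^-1` [set j]).
Proof.
have -> : label @^-1` [set j] =
    [set delta_mx 0 j] `|` (if j == ord0 then ~` basis else set0).
  apply/seteqP; split=> v /=.
    move=> jv; have [bv|nbv] := pselect (basis v).
      by left; rewrite -jv -(basisP _).1.
    right; suff -> : j = ord0 by rewrite eqxx.
    rewrite -jv /label; case: pickP => // i /eqP vi.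
    by case: nbv; exists i.
  move=> [->|]; first by rewrite label_delta.
  case: eqP => [->|] // nb; rewrite /label; case: pickP => // i /eqP vi.
  by case: nb; exists i.
apply: measurableU; first exact: borel_rV_set1.
by case: ifP => _ //; apply: measurableC; exact: basis_measurable.
Qed.

Section random_label.
Variables (dO : measure_display) (Omega : measurableType dO) (P : probability Omega K).
Variable V : {RV P >-> borel_rV K d}.
Hypothesis V_law : forall j : 'I_d,
  P (V @^-1` [set (delta_mx 0 j : 'rV[K]_d)]) = (d%:R^-1)%:E.

Let mV (B : set (borel_rV K d)) : measurable B -> measurable (V @^-1` B).
Proof. by move=> mB; rewrite -[X in measurable X]setTI; exact: measurable_funPT. Qed.

(** The d disjoint atoms of mass 1 / d exhaust the probability. *)
Lemma prob_basis : P (V @^-1` basis) = 1%E.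
Proof.
have -> : V @^-1` basis = \big[setU/set0]_(j < d) (V @^-1` [set (delta_mx 0 j : 'rV[K]_d)]).
  rewrite -bigcup_seq; apply/seteqP; split=> t /= [j _ Vj]; exists j => //=.
  exact: mem_index_enum.
rewrite measure_bigsetU_ord.
- rewrite (eq_bigr (fun=> (d%:R^-1)%:E)) => [|j _]; last exact: V_law.
  by rewrite sumEFin sumr_const card_ord -[_ *+ _]mulr_natl mulfV ?pnatr_eq0.
- by move=> j; apply: mV; exact: borel_rV_set1.
- move=> i j _ _ [t [/= -> ]] /(congr1 label); rewrite !label_delta => ->//.
Qed.

Lemma prob_label j : P (V @^-1` (label @^-1` [set j])) = (d%:R^-1)%:E.
Proof.
rewrite -(V_law j) -label_basis preimage_setI.
have mL := mV (label_measurable j); have mB := mV basis_measurable.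
have H : P (V @^-1` (label @^-1` [set j]) `&` ~` (V @^-1` basis)) = 0%E.
  apply: (@subset_measure0 _ _ _ _ _ (~` (V @^-1` basis))) => //.
  - by apply: measurableI => //; exact: measurableC.
  - exact: measurableC.
  - by rewrite [LHS](probability_setC P mB) prob_basis subee.
rewrite [LHS](measureDI _ mL mB) setDE [X in (X + _)%E]H add0e//.
Qed.

End random_label.
End labels.

(** * Lindeberg's method *)

(* [square_min_bound] is applied to [a = (R_k^2 - 1) / c], which has only two
   moments and needs the indicator, and [b = 2 R_k <V_k, S_k> / c], which has
   four. *)
Lemma square_min_bound (K : realType) (e a b : K) : 0 < e ->
  (a + b) ^+ 2 * Num.min 1 `|a + b| <=
  2 * e * (a ^+ 2 + b ^+ 2) + 4 * (a ^+ 2 * \1_[set y | e / 2 < `|y|] a)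
  + 16 / e ^+ 2 * b ^+ 4.
Proof.
move=> e0; set x := a + b.
have ind0 : 0 <= (\1_[set y | e / 2 < `|y|] a : K) by rewrite indicE; case: (_ \in _).
have e20 : 0 < e ^+ 2 by rewrite exprn_gt0.
have b40 : 0 <= b ^+ 4 by rewrite exprn_even_ge0.
have a20 := sqr_ge0 a; have b20 := sqr_ge0 b.
have t1 : 0 <= 2 * e * (a ^+ 2 + b ^+ 2).
  by apply: mulr_ge0; [apply: mulr_ge0 => //; exact: ltW|exact: addr_ge0].
have t2 : 0 <= 4 * (a ^+ 2 * \1_[set y | e / 2 < `|y|] a).
  by apply: mulr_ge0 => //; exact: mulr_ge0.
have t3 : 0 <= 16 / e ^+ 2 * b ^+ 4.
  by apply: mulr_ge0 => //; apply: divr_ge0 => //; exact: ltW.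
have x2 : x ^+ 2 <= 2 * (a ^+ 2 + b ^+ 2) by have := sqr_ge0 (a - b); rewrite /x !expr2; lra.
(* If |a + b| > e, the larger of |a| and |b| exceeds e / 2. If it is |a|, the indicator is 1; if it
   is |b|, then 4 b^2 <= 16 b^4 / e^2. *)
have [xe|ex] := leP `|x| e.
  apply: (@le_trans _ _ (2 * e * (a ^+ 2 + b ^+ 2))); last by lra.
  apply: (@le_trans _ _ (x ^+ 2 * e)).
    by rewrite ler_wpM2l ?sqr_ge0// ge_min xe orbT.
  have -> : 2 * e * (a ^+ 2 + b ^+ 2) = 2 * (a ^+ 2 + b ^+ 2) * e by ring.
  by apply: ler_wpM2r => //; exact: ltW.
apply: (@le_trans _ _ (x ^+ 2)).
  by rewrite ler_piMr ?sqr_ge0// ge_min lexx.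
have xab : `|x| <= `|a| + `|b| by exact: ler_normD.
have [ba|ab] := leP `|b| `|a|.
  have ae : e / 2 < `|a| by lra.
  have bb : b ^+ 2 <= a ^+ 2 by rewrite -(real_normK (num_real b)) -(real_normK (num_real a)) lerXn2r ?nnegrE.
  have -> : \1_[set y | e / 2 < `|y|] a = 1 :> K by rewrite indicE mem_set.
  lra.
have be : e / 2 < `|b| by lra.
have aa : a ^+ 2 <= b ^+ 2 by rewrite -(real_normK (num_real b)) -(real_normK (num_real a)) lerXn2r ?nnegrE// ltW.
suff : 4 * b ^+ 2 <= 16 / e ^+ 2 * b ^+ 4 by lra.
have eb : e ^+ 2 <= 4 * b ^+ 2.
  rewrite -(real_normK (num_real b)).
  have : e ^+ 2 <= (2 * `|b|) ^+ 2 by rewrite lerXn2r ?nnegrE ?ltW//; lra.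
  by rewrite exprMn; lra.
have -> : 16 / e ^+ 2 * b ^+ 4 = (4 * b ^+ 2) * (4 * b ^+ 2) / e ^+ 2.
  by rewrite -[4%N]/(2 + 2)%N exprD; field; rewrite gt_eqF.
rewrite ler_pdivlMr// ler_wpM2l// mulr_ge0// sqr_ge0.
Qed.

(** Cauchy-Schwarz, obtained from E (|X| - m)^2 >= 0 with m = E |X|; integrability of |X| comes
    first, from |X| <= 1 + X^2. *)
Lemma abs_moment_le (K : realType) d (T : measurableType d) (P : probability T K)
    (X : T -> K) (q : K) :
  measurable_fun setT X -> P.-integrable setT (EFin \o (fun t => X t ^+ 2)) ->
  \int[P]_t (X t ^+ 2) <= q ->
  P.-integrable setT (EFin \o (fun t => `|X t|)) /\ \int[P]_t `|X t| <= Num.sqrt q.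
Proof.
move=> mX iX2 Xq.
have mnX : measurable_fun setT (fun t => `|X t|) by exact: measurableT_comp.
have i1 : P.-integrable setT (EFin \o (fun t => 1 + X t ^+ 2)).
  exact: (integrableD measurableT (integrable_cstT P 1) iX2).
have iX : P.-integrable setT (EFin \o (fun t => `|X t|)).
  apply: (integrable_dominated mnX i1) => t; rewrite normr_id.
  by have := sqr_ge0 (`|X t| - 1); rewrite -(real_normK (num_real (X t))); nra.
split=> //; set m := \int[P]_t `|X t|.
have m0 : 0 <= m by exact: Rintegral_ge0.
have i2 := integrableZl measurableT (2 * m) iX.
have i3 : P.-integrable setT (EFin \o (fun t => X t ^+ 2 - 2 * m * `|X t|)).
  exact: (integrableB measurableT iX2 i2).
have : 0 <= \int[P]_t (X t ^+ 2 - 2 * m * `|X t| + m ^+ 2).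
  apply: Rintegral_ge0 => t _; rewrite -(real_normK (num_real (X t))).
  by have := sqr_ge0 (`|X t| - m); rewrite !expr2; lra.
rewrite RintegralD//; last exact: integrable_cstT.
rewrite RintegralB// RintegralZl// Rintegral_cstT -/m => H.
rewrite -(ger0_norm m0) -sqrtr_sqr ler_sqrt.
  by move: H; rewrite expr2; lra.
by rewrite (le_trans _ Xq)// Rintegral_ge0// => t _; exact: sqr_ge0.
Qed.

(* [n] steps in dimension [D], scale [c]; [m3], [m4], [beta] and [tail] stand for
   E R^3, E R^4, E (R^2 - 1)^2 and E (R^2 - 1)^2 1_{|R^2 - 1| > c e / 2}. *)
Definition lindeberg_error (K : realType) (C c e n D m3 m4 beta tail : K) : K :=
  n * (2 * C / (c ^+ 2 * D) * (`|m3| * Num.sqrt n + Num.sqrt (n * beta + 2 * n ^+ 2 / D)) +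
    C * (2 * e * ((beta + 4 * n / D) / c ^+ 2) + 4 * tail / c ^+ 2 +
      256 * m4 * (n * m4 / D + 3 * n ^+ 2 / D ^+ 2) / (c ^+ 4 * e ^+ 2) +
      ((beta + 4 * n / D) / c ^+ 2) ^+ 2)).

Lemma sum_pick (K : realType) (T : finType) (i : T) (F : T -> K) :
  \sum_j (i == j)%:R * F j = F i.
Proof.
rewrite (bigD1 i)//= eqxx mul1r big1 ?addr0// => j ji.
by rewrite eq_sym (negbTE ji) mul0r.
Qed.

Section model.
Variables (K : realType) (d' : nat).
Let d := d'.+1.
Variables (dOO : measure_display) (Omega0 : measurableType dOO) (P0 : probability Omega0 K).
Variable R : {RV P0 >-> K}.
Variables (dO : measure_display) (Omega : measurableType dO) (P : probability Omega K).
Variables (Ri : nat -> {RV P >-> K}) (V : nat -> {RV P >-> borel_rV K d}).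
Hypothesis Ri_indep : independent_seq P Ri.
Hypothesis V_indep : independent_seq P V.
Hypothesis RV_indep : independent2 P (sigma_seq Ri) (sigma_seq V).
Hypothesis Ri_law : forall i, same_law (Ri i) R.
Hypothesis V_law : forall i (j : 'I_d),
  P (V i @^-1` [set (delta_mx 0 j : 'rV[K]_d)]) = (d%:R^-1)%:E.
Hypothesis iR4 : P0.-integrable setT (EFin \o (fun w => R w ^+ 4)).

Notation past := (past Ri V).

Lemma same_law_Rintegral i (h : K -> K) : measurable_fun setT h ->
  P0.-integrable setT (EFin \o (h \o R)) ->
  P.-integrable setT (EFin \o (h \o Ri i)) /\
  \int[P]_t h (Ri i t) = \int[P0]_w h (R w).
Proof.
move=> mh ih.
have mhE : measurable_fun setT (EFin \o h) by exact/measurable_EFinP.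
have lawE (f : K -> \bar K) :
    (\int[distribution P (Ri i)]_x f x = \int[distribution P0 R]_x f x)%E.
  by apply: eq_measure_integral => A mA _; exact: Ri_law.
have ihi : P.-integrable setT (EFin \o (h \o Ri i)).
  apply/integrableP; split.
    by apply/measurable_EFinP; apply: measurableT_comp.
  have := (integrableP _ _ _ ih).2.
  have mabs : measurable_fun setT (abse \o (EFin \o h)) by exact: measurableT_comp.
  have abs0 x : (0 <= (abse \o (EFin \o h)) x)%E by exact: abse_ge0.
  rewrite -[X in (X < _ -> _)%E](ge0_integral_distribution R mabs abs0).
  by rewrite -lawE (ge0_integral_distribution _ mabs abs0).
split=> //; congr fine.
by rewrite -(integral_distribution mhE ihi) lawE integral_distribution.
Qed.

Lemma quartic_integrable (h : K -> K) (C : K) : measurable_fun setT h ->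
  (forall x, `|h x| <= C * (1 + x ^+ 4)) -> P0.-integrable setT (EFin \o (h \o R)).
Proof.
move=> mh hC; apply: (@integrable_dominated _ _ _ P0 _ (fun w => C * (1 + R w ^+ 4))).
- by apply: (measurableT_comp mh).
- exact: (integrableZl measurableT C (integrableD measurableT (integrable_cstT P0 1) iR4)).
- by move=> w; exact: hC.
Qed.

Definition lab (i : nat) (t : Omega) : 'I_d := label (V i t).

Let lab_ind i j : (fun t => (lab i t == j)%:R : K) =
  \1_(V i @^-1` (@label K d' @^-1` [set j])).
Proof.
apply/funext => t; rewrite indicE /lab; congr (_%:R); congr nat_of_bool.
by apply/eqP/idP => [|]; rewrite inE.
Qed.

Lemma past_lab a b i j : (i < b)%N -> past a b (fun t => (lab i t == j)%:R).
Proof. by move=> ib; rewrite lab_ind; apply: past_V => //; exact: label_measurable. Qed.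

Lemma past_mono a b b' X : (b <= b')%N -> past a b X -> past a b' X.
Proof.
move=> bb' pX _ C mC; rewrite setTI.
have := pX measurableT C mC; rewrite setTI.
apply: sub_smallest2r => // _ [A [B [mA mB ->]]].
exists A, (fun i => if (i < b)%N then B i else setT); split => //.
  by move=> i; case: ifP.
congr (_ `&` _); apply/seteqP; split=> t /= Bt i /= ib.
  by case: ifPn => // ilt; exact: Bt.
by have /= := Bt i (leq_trans ib bb'); rewrite ib.
Qed.

Lemma expect_stepR k X (h : K -> K) : past k k X ->
  P.-integrable setT (EFin \o X) -> measurable_fun setT h ->
  P0.-integrable setT (EFin \o (h \o R)) ->
  P.-integrable setT (EFin \o (fun t => X t * h (Ri k t))) /\
  \int[P]_t (X t * h (Ri k t)) = \int[P]_t X t * \int[P0]_w h (R w).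
Proof.
move=> pX iX mh ih; have [ihk <-] := same_law_Rintegral k mh ih.
have XY : indep_rv P X (h \o Ri k) by exact: (past_indepR Ri_indep V_indep RV_indep pX mh).
have mX := past_measurable pX.
have mhk : measurable_fun setT (h \o Ri k) by exact: measurableT_comp.
split; first exact: (integrable_indepM mX mhk iX ihk XY).
exact: (Rintegral_indepM mX mhk iX ihk XY).
Qed.

(* The label [lab k] is independent of the past and uniform, and [Ri k] is
   independent of both. *)
Lemma expect_step k (F : 'I_d -> Omega -> K) (h : K -> K) :
  (forall j, past k k (F j)) -> (forall j, P.-integrable setT (EFin \o F j)) ->
  measurable_fun setT h -> P0.-integrable setT (EFin \o (h \o R)) ->
  P.-integrable setT (EFin \o (fun t => h (Ri k t) * F (lab k t) t)) /\
  \int[P]_t (h (Ri k t) * F (lab k t) t) =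
  \int[P0]_w h (R w) * ((\sum_j \int[P]_t F j t) / d%:R).
Proof.
move=> pF iF mh ih.
have mF j := past_measurable (pF j).
have mC j : measurable (V k @^-1` (@label K d' @^-1` [set j])).
  by rewrite -[X in measurable X]setTI; apply: measurable_funPT => //; exact: label_measurable.
pose G j t := F j t * (lab k t == j)%:R.
have GE j : P.-integrable setT (EFin \o G j) /\ \int[P]_t G j t = \int[P]_t F j t / d%:R.
  have lE t : (lab k t == j)%:R = \1_(V k @^-1` (@label K d' @^-1` [set j])) t :> K.
    exact: (congr1 (fun f => f t) (lab_ind k j)).
  have mI : measurable_fun setT (\1_(V k @^-1` (@label K d' @^-1` [set j])) : Omega -> K).
    exact: measurable_indic.
  have iI : P.-integrable setT (EFin \o (\1_(V k @^-1` (@label K d' @^-1` [set j])))).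
    exact: integrable_indic.
  have XY := past_indepV Ri_indep V_indep RV_indep (pF j) (label_measurable j).
  have -> : G j = F j \* \1_(V k @^-1` (@label K d' @^-1` [set j])).
    by apply/funext => t; rewrite /G lE.
  split; first exact: (integrable_indepM (mF j) mI (iF j) iI XY).
  rewrite (Rintegral_indepM (mF j) mI (iF j) iI XY); congr (_ * _).
  rewrite /Rintegral integral_indic// setIT.
  by rewrite [X in fine X](prob_label (V_law k)).
(* [G j] involves V_k but not R_k, so it belongs to the past with k radii and k + 1 directions, of
   which R_k is still independent. *)
have pG j : past k k.+1 (G j).
  by apply: measurable_funM; [exact: past_mono (pF j)|exact: past_lab].
have mhk : measurable_fun setT (h \o Ri k) by exact: measurableT_comp.
have [ihk ihE] := same_law_Rintegral k mh ih.
have HE j : P.-integrable setT (EFin \o (fun t => G j t * h (Ri k t))) /\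
    \int[P]_t (G j t * h (Ri k t)) = \int[P]_t F j t / d%:R * \int[P0]_w h (R w).
  have XY := past_indepR Ri_indep V_indep RV_indep (pG j) mh.
  have mG := past_measurable (pG j); have [iG eG] := GE j.
  split; first exact: (integrable_indepM mG mhk iG ihk XY).
  by rewrite (Rintegral_indepM mG mhk iG ihk XY) eG ihE.
have -> : (fun t => h (Ri k t) * F (lab k t) t) =
    (fun t => \sum_j G j t * h (Ri k t)).
  apply/funext => t; rewrite -big_distrl/= mulrC; congr (_ * _).
  by rewrite -(sum_pick (lab k t) (fun j => F j t)); apply: eq_bigr => j _; rewrite mulrC.
have [iS eS] := @Rintegral_sum _ _ _ P _ (index_enum 'I_d) _ (fun j => (HE j).1).
split=> //; rewrite eS (eq_bigr _ (fun j _ => (HE j).2)) -!big_distrl/=.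
by rewrite mulrC.
Qed.

(** Induction by (x + y)^4 <= 8 (x^4 + y^4). This single majorant gives the integrability of all
    tame variables. *)
Lemma integrable_quartic_sum n :
  P.-integrable setT (EFin \o (fun t => (1 + \sum_(i < n) `|Ri i t|) ^+ 4)).
Proof.
have conv4 (x y : K) : (x + y) ^+ 4 <= 8 * (x ^+ 4 + y ^+ 4).
  have e (z : K) : z ^+ 4 = (z ^+ 2) ^+ 2 by rewrite -exprM.
  have h (z u : K) : (z + u) ^+ 2 <= 2 * (z ^+ 2 + u ^+ 2).
    by have := sqr_ge0 (z - u); rewrite !expr2; lra.
  rewrite !e (@le_trans _ _ ((2 * (x ^+ 2 + y ^+ 2)) ^+ 2))//.
    by rewrite lerXn2r ?nnegrE ?sqr_ge0// mulr_ge0// addr_ge0 ?sqr_ge0.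
  by rewrite exprMn; have := h (x ^+ 2) (y ^+ 2); lra.
elim: n => [|n IH].
  apply: (@bounded_integrable _ _ _ P _ 1).
    by under eq_fun do rewrite big_ord0 addr0 expr1n; exact: measurable_cst.
  by move=> t; rewrite big_ord0 addr0 expr1n normr1.
have [iRn _] := @same_law_Rintegral n (fun x => x ^+ 4) (measurable_funX _ (@measurable_id _ _ _)) iR4.
apply: (integrable_dominated _ (integrableZl measurableT 8 (integrableD measurableT IH iRn))).
  apply: measurable_funX; apply: measurable_funD => //; apply: measurable_sum => i.
  exact: measurableT_comp.
move=> t /=; rewrite big_ord_recr/= addrA ger0_norm; last first.
  by rewrite exprn_even_ge0.
rewrite (le_trans (conv4 _ _))//.
by rewrite -(normrX 4 (Ri n t)) (@ger0_norm _ (Ri n t ^+ 4)) ?exprn_even_ge0.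
Qed.

(** * Random variables of polynomial growth in the radii *)

Section tame.
Variable N : nat.

(** The summand 1 gives Q >= 1, so the powers of Q increase and an exponent can be read as a degree
    in the radii; labels are bounded and have degree 0. N is the time horizon, fixed throughout. *)
Let Q t := 1 + \sum_(i < N) `|Ri i t|.

(* Every [X] with [tame 4 X] is integrable, because R has a fourth moment. *)
Definition tame (p : nat) (X : Omega -> K) :=
  measurable_fun setT X /\ exists2 C : K, 0 <= C & forall t, `|X t| <= C * Q t ^+ p.

Let Q1 t : 1 <= Q t.
Proof. by rewrite /Q lerDl sumr_ge0. Qed.

Let Q0 t : 0 <= Q t. Proof. by rewrite (le_trans _ (Q1 t)). Qed.

Implicit Types (X Y : Omega -> K) (c B : K).

Lemma tame_cst c : tame 0 (fun=> c).
Proof. by split=> //; exists `|c| => // t; rewrite expr0 mulr1. Qed.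

Lemma tame_bounded X B : measurable_fun setT X -> (forall t, `|X t| <= B) -> tame 0 X.
Proof.
move=> mX XB; split=> //; exists `|B| => // t; rewrite expr0 mulr1.
by rewrite (le_trans (XB t))// ler_norm.
Qed.

Lemma tameW p q X : (p <= q)%N -> tame p X -> tame q X.
Proof.
move=> pq [mX [C C0 XC]]; split=> //; exists C => // t.
by rewrite (le_trans (XC t))// ler_wpM2l// ler_weXn2l.
Qed.

Lemma tameD p X Y : tame p X -> tame p Y -> tame p (fun t => X t + Y t).
Proof.
move=> [mX [C C0 XC]] [mY [C' C'0 YC]]; split; first exact: measurable_funD.
exists (C + C'); first exact: addr_ge0.
by move=> t; rewrite mulrDl (le_trans (ler_normD _ _))// lerD.
Qed.

Lemma tameM p q X Y : tame p X -> tame q Y -> tame (p + q) (fun t => X t * Y t).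
Proof.
move=> [mX [C C0 XC]] [mY [C' C'0 YC]]; split; first exact: measurable_funM.
exists (C * C'); first exact: mulr_ge0.
by move=> t; rewrite exprD mulrACA normrM ler_pM.
Qed.

Lemma tameX p n X : tame p X -> tame (n * p) (fun t => X t ^+ n).
Proof.
move=> tX; elim: n => [|n IH]; first exact: (tame_cst 1).
have -> : (fun t => X t ^+ n.+1) = (fun t => X t * X t ^+ n).
  by apply/funext => t; rewrite exprS.
by rewrite mulSn; exact: tameM.
Qed.

Lemma tameZ p c X : tame p X -> tame p (fun t => c * X t).
Proof. by move=> tX; rewrite -[p]add0n; apply: tameM => //; exact: tame_cst. Qed.

Lemma tameB p X Y : tame p X -> tame p Y -> tame p (fun t => X t - Y t).
Proof.
move=> tX tY; have := tameD tX (tameZ (-1) tY).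
by congr tame; apply/funext => t; rewrite mulN1r.
Qed.

Lemma tame_sum p (I : finType) (X : I -> Omega -> K) : (forall i, tame p (X i)) ->
  tame p (fun t => \sum_i X i t).
Proof.
move=> tX; elim: (index_enum I) => [|i r IH].
  have -> : (fun t => \sum_(i <- [::]) X i t) = (fun=> 0).
    by apply/funext => t; rewrite big_nil.
  by apply: (tameW (leq0n p)); exact: tame_cst.
have -> : (fun t => \sum_(j <- i :: r) X j t) = (fun t => X i t + \sum_(j <- r) X j t).
  by apply/funext => t; rewrite big_cons.
exact: tameD.
Qed.

Lemma tame_R i : (i < N)%N -> tame 1 (Ri i).
Proof.
move=> iN; split=> //; exists 1 => // t; rewrite mul1r expr1 /Q.
rewrite (bigD1 (Ordinal iN))//= addrCA lerDl addr_ge0// sumr_ge0//.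
Qed.

Lemma tame_integrable X : tame 4 X -> P.-integrable setT (EFin \o X).
Proof.
move=> [mX [C C0 XC]]; apply: (integrable_dominated mX _ XC).
exact: (integrableZl measurableT C (integrable_quartic_sum N)).
Qed.

Lemma expectD X Y : tame 4 X -> tame 4 Y ->
  \int[P]_t (X t + Y t) = \int[P]_t X t + \int[P]_t Y t.
Proof. by move=> tX tY; rewrite RintegralD//; exact: tame_integrable. Qed.

Lemma expectZ c X : tame 4 X -> \int[P]_t (c * X t) = c * \int[P]_t X t.
Proof. by move=> tX; rewrite RintegralZl//; exact: tame_integrable. Qed.

(** * Moments of one step and of the walk *)

Hypothesis ER1 : \int[P0]_w R w = 0.
Hypothesis ER2 : \int[P0]_w (R w ^+ 2) = 1.

Let m3 := \int[P0]_w (R w ^+ 3).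
Let m4 := \int[P0]_w (R w ^+ 4).
Let beta := \int[P0]_w ((R w ^+ 2 - 1) ^+ 2).

Let mpow n : measurable_fun setT (fun x : K => x ^+ n).
Proof. exact: measurable_funX. Qed.

Let pow4 (x : K) : x ^+ 4 = x ^+ 2 * x ^+ 2. Proof. by rewrite -exprD. Qed.

Let pow3 (x : K) : x ^+ 3 = x * x ^+ 2. Proof. by rewrite exprS. Qed.

Let ipow1 : P0.-integrable setT (EFin \o (id \o R)).
Proof.
apply: (@quartic_integrable _ 1); first exact: measurable_id.
move=> x; rewrite mul1r ler_norml pow4.
have h1 := sqr_ge0 (x ^+ 2 - 1); have h2 := sqr_ge0 (x - 1).
have h3 := sqr_ge0 (x + 1); have h4 := sqr_ge0 (x ^+ 2).
by apply/andP; split; nra.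
Qed.

Let ipow2 : P0.-integrable setT (EFin \o ((fun x => x ^+ 2) \o R)).
Proof.
apply: (@quartic_integrable _ 1) => //.
move=> x; rewrite mul1r ler_norml pow4.
have h1 := sqr_ge0 (x ^+ 2 - 1); have h2 := sqr_ge0 (x - 1).
have h3 := sqr_ge0 (x + 1); have h4 := sqr_ge0 (x ^+ 2).
by apply/andP; split; nra.
Qed.

Let ipow3 : P0.-integrable setT (EFin \o ((fun x => x ^+ 3) \o R)).
Proof.
apply: (@quartic_integrable _ 1) => //.
move=> x; rewrite mul1r ler_norml pow3 pow4.
have h1 := sqr_ge0 (x ^+ 2 - 1); have h2 := sqr_ge0 (x * (x - 1)).
have h3 := sqr_ge0 (x * (x + 1)).
by apply/andP; split; nra.
Qed.

Let ipow4 : P0.-integrable setT (EFin \o ((fun x => x ^+ 4) \o R)).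
Proof. exact: iR4. Qed.

Let mcen : measurable_fun setT (fun x : K => x ^+ 2 - 1).
Proof. exact: measurable_funB. Qed.

Let icen : P0.-integrable setT (EFin \o ((fun x => x ^+ 2 - 1) \o R)).
Proof. exact: (integrableB measurableT ipow2 (integrable_cstT P0 1)). Qed.

Let Ecen : \int[P0]_w (R w ^+ 2 - 1) = 0.
Proof.
by rewrite (RintegralB measurableT ipow2 (integrable_cstT P0 1)) ER2 Rintegral_cstT subrr.
Qed.

Let mcen2 : measurable_fun setT (fun x : K => (x ^+ 2 - 1) ^+ 2).
Proof. exact: measurable_funX. Qed.

Let icen2 : P0.-integrable setT (EFin \o ((fun x => (x ^+ 2 - 1) ^+ 2) \o R)).
Proof.
apply: (@quartic_integrable _ 2) => //.
move=> x; rewrite ger0_norm ?sqr_ge0// pow4.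
by have := sqr_ge0 (x ^+ 2 + 1); rewrite !expr2; lra.
Qed.

(** R^3 - R = (R^2 - 1) R is the weight of the cross term in the square of [incr]. *)
Let mcenx : measurable_fun setT (fun x : K => x ^+ 3 - x).
Proof. exact: measurable_funB. Qed.

Let icenx : P0.-integrable setT (EFin \o ((fun x => x ^+ 3 - x) \o R)).
Proof. exact: (integrableB measurableT ipow3 ipow1). Qed.

Let Ecenx : \int[P0]_w (R w ^+ 3 - R w) = m3.
Proof. by rewrite (RintegralB measurableT ipow3 ipow1) ER1 subr0. Qed.

(** The walk is rebuilt from the labels instead of from V. The algebraic identities below then hold
    at every point of [Omega], and the null event where some V_i is not a basis vector has to be
    handled only in [Rintegral_walk]. *)
Definition coord k j t := \sum_(i < k) Ri i t * (lab i t == j)%:R.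
Definition sqnorm k t := \sum_j coord k j t ^+ 2.
Definition total k t := \sum_(i < k) Ri i t.
(* [sel k] is <S_k, V_k>, and [incr k] is |S_(k+1)|^2 - |S_k|^2 - 1. *)
Definition sel k t := coord k (lab k t) t.
Definition incr k t := (Ri k t ^+ 2 - 1) + 2 * (Ri k t * sel k t).

Lemma coordS k j t : coord k.+1 j t = coord k j t + Ri k t * (lab k t == j)%:R.
Proof. by rewrite /coord big_ord_recr. Qed.

Lemma coord0 j t : coord 0 j t = 0. Proof. by rewrite /coord big_ord0. Qed.

Lemma sum_coord k t : \sum_j coord k j t = total k t.
Proof.
rewrite /coord exchange_big/=; apply: eq_bigr => i _.
by rewrite -big_distrr/= -[RHS]mulr1 -[in RHS](sum_pick (lab i t) (fun=> 1));
  congr (_ * _); apply: eq_bigr => j _; rewrite mulr1.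
Qed.

Lemma sqnormS k t : sqnorm k.+1 t = sqnorm k t + incr k t + 1.
Proof.
have -> : sqnorm k.+1 t = \sum_j (coord k j t ^+ 2 +
    (lab k t == j)%:R * (2 * (Ri k t * coord k j t) + Ri k t ^+ 2)).
  apply: eq_bigr => j _; rewrite coordS.
  by case: (lab k t == j); rewrite ?mulr1 ?mulr0 ?addr0 ?mul0r ?addr0 ?mul1r//; ring.
by rewrite big_split/= sum_pick /incr /sel -/(sqnorm k t); ring.
Qed.

Lemma past_coord k j : past k k (coord k j).
Proof.
apply: measurable_sum => i; apply: measurable_funM.
  exact: past_R.
exact: past_lab.
Qed.

Lemma past_sqnorm k : past k k (sqnorm k).
Proof. by apply: measurable_sum => j; apply: measurable_funX; exact: past_coord. Qed.

Lemma past_total k : past k k (total k).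
Proof. by apply: measurable_sum => i; exact: past_R. Qed.

Lemma tame_lab i j : tame 0 (fun t => (lab i t == j)%:R).
Proof.
apply: (@tame_bounded _ 1).
  apply: (@past_measurable _ _ _ P d Ri V i.+1 i.+1); exact: past_lab.
by move=> t; case: (_ == _); rewrite ?normr1 ?normr0.
Qed.

Lemma tame_coord k j : (k <= N)%N -> tame 1 (coord k j).
Proof.
move=> kN; apply: tame_sum => i; rewrite -[1%N]addn0; apply: tameM; last exact: tame_lab.
by apply: tame_R; rewrite (leq_trans (ltn_ord i)).
Qed.

Lemma tame_sqnorm k : (k <= N)%N -> tame 2 (sqnorm k).
Proof. by move=> kN; apply: tame_sum => j; apply: (tameX 2 (tame_coord j kN)). Qed.

Lemma tame_total k : (k <= N)%N -> tame 1 (total k).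
Proof. by move=> kN; apply: tame_sum => i; apply: tame_R; rewrite (leq_trans (ltn_ord i)). Qed.

Lemma tame_sel k : (k <= N)%N -> tame 1 (sel k).
Proof.
move=> kN; have -> : sel k = (fun t => \sum_j (lab k t == j)%:R * coord k j t).
  by apply/funext => t; rewrite (sum_pick (lab k t) (fun j => coord k j t)).
by apply: tame_sum => j; apply: (tameM (tame_lab k j) (tame_coord j kN)).
Qed.

Lemma tame_incr k : (k < N)%N -> tame 2 (incr k).
Proof.
move=> kN; apply: tameD.
  apply: tameB; first exact: (tameX 2 (tame_R kN)).
  by apply: (@tameW 0) => //; exact: tame_cst.
by apply: tameZ; apply: (tameM (tame_R kN)); apply: tame_sel; exact: ltnW.
Qed.

Lemma expect_lab k j X (h : K -> K) : past k k X -> P.-integrable setT (EFin \o X) ->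
  measurable_fun setT h -> P0.-integrable setT (EFin \o (h \o R)) ->
  P.-integrable setT (EFin \o (fun t => h (Ri k t) * ((lab k t == j)%:R * X t))) /\
  \int[P]_t (h (Ri k t) * ((lab k t == j)%:R * X t)) =
  \int[P0]_w h (R w) * (\int[P]_t X t / d%:R).
Proof.
move=> pX iX mh ih.
have pF (i : 'I_d) : past k k (fun t => (i == j)%:R * X t) by exact: measurable_funM.
have iF (i : 'I_d) : P.-integrable setT (EFin \o (fun t => (i == j)%:R * X t)).
  exact: (integrableZl measurableT _ iX).
have [i1 e1] := expect_step pF iF mh ih.
split=> //; rewrite e1; congr (_ * (_ / _)).
under eq_bigr do rewrite RintegralZl// eq_sym.
exact: sum_pick.
Qed.

Lemma expect_coord k j : (k <= N)%N -> \int[P]_t coord k j t = 0.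
Proof.
elim: k => [|k IH] kN; first by under eq_Rintegral do rewrite coord0; rewrite Rintegral_cstT.
have kN' := ltnW kN.
have [_ e1] := @expect_lab k j (fun=> 1) id (measurable_cst _) (integrable_cstT P 1)
  (@measurable_id _ _ _) ipow1.
have tb : tame 1 (fun t => Ri k t * ((lab k t == j)%:R * 1)).
  apply: (tameM (tame_R kN)); apply: (tameM (tame_lab k j)); exact: tame_cst.
rewrite (_ : (fun t => _) = (fun t => coord k j t + Ri k t * ((lab k t == j)%:R * 1))); last first.
  by apply/funext => t; rewrite coordS mulr1.
rewrite expectD ?e1 ?IH ?ER1 ?mul0r ?addr0//.
  exact: tameW (tame_coord j kN').
exact: tameW tb.
Qed.

Lemma expect_coord2 k j : (k <= N)%N -> \int[P]_t (coord k j t ^+ 2) = k%:R / d%:R.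
Proof.
elim: k => [|k IH] kN.
  by under eq_Rintegral do rewrite coord0 expr0n; rewrite Rintegral_cstT mul0r.
have kN' := ltnW kN; have tc := tame_coord j kN'; have tl := tame_lab k j; have tR := tame_R kN.
have [_ e1] := expect_lab j (@past_coord k j)
  (tame_integrable (tameW (isT : (1 <= 4)%N) tc)) (@measurable_id _ _ _) ipow1.
have [_ e2] := @expect_lab k j (fun=> 1) (fun x => x ^+ 2) (measurable_cst _)
  (integrable_cstT P 1) (mpow 2) ipow2.
have -> : (fun t => coord k.+1 j t ^+ 2) = (fun t => coord k j t ^+ 2 +
    (2 * (Ri k t * ((lab k t == j)%:R * coord k j t)) +
     Ri k t ^+ 2 * ((lab k t == j)%:R * 1))).
  by apply/funext => t; rewrite coordS; case: (_ == _) => /=; ring.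
have t1 : tame 4 (fun t => Ri k t * ((lab k t == j)%:R * coord k j t)).
  by apply: (@tameW 2) => //; apply: (tameM tR (tameM tl tc)).
have t2 : tame 4 (fun t => Ri k t ^+ 2 * ((lab k t == j)%:R * 1)).
  by apply: (@tameW 2) => //; apply: (tameM (tameX 2 tR) (tameM tl (tame_cst 1))).
rewrite expectD; [|by apply: (@tameW 2) => //; exact: (tameX 2 tc)|by apply: tameD => //; exact: tameZ].
rewrite expectD ?expectZ//; last exact: tameZ.
rewrite e1 e2 IH// ER1 ER2 Rintegral_cstT -natr1; ring.
Qed.

(** One step adds m4 / d + 6 k / d^2 to the moment: in the binomial expansion the terms with R and
    R^3 vanish, because E R = 0 and because the coordinate has mean 0, and the term with R^2 uses
    [expect_coord2]. Summing 6 k gives 3 k (k - 1), which is bounded by 3 k^2. *)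
Lemma expect_coord4 k j : (k <= N)%N ->
  \int[P]_t (coord k j t ^+ 4) <= k%:R * m4 / d%:R + 3 * k%:R ^+ 2 / d%:R ^+ 2.
Proof.
move=> kN; suff -> : \int[P]_t (coord k j t ^+ 4) =
    k%:R * m4 / d%:R + 3 * k%:R * (k%:R - 1) / d%:R ^+ 2.
  rewrite lerD2l ler_wpM2r ?invr_ge0 ?exprn_ge0// -mulrA ler_wpM2l// expr2.
  by rewrite ler_wpM2l// gerBl.
elim: k kN => [|k IH] kN.
  under eq_Rintegral do rewrite coord0 expr0n.
  by rewrite Rintegral_cstT !mul0r mulr0 !mul0r addr0.
have kN' := ltnW kN; have tc := tame_coord j kN'; have tl := tame_lab k j; have tR := tame_R kN.
have pc := @past_coord k j.
have pcn n : past k k (fun t => coord k j t ^+ n) by exact: measurable_funX.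
have tcn n : tame n (fun t => coord k j t ^+ n) by have := tameX n tc; rewrite muln1.
have ic n : (n <= 4)%N -> P.-integrable setT (EFin \o (fun t => coord k j t ^+ n)).
  by move=> n4; apply: tame_integrable; apply: tameW (tcn n).
have [_ e1] := expect_lab j (pcn 3) (ic 3 isT) (@measurable_id _ _ _) ipow1.
have [_ e2] := expect_lab j (pcn 2) (ic 2 isT) (mpow 2) ipow2.
have [_ e3] := expect_lab j (pcn 1) (ic 1 isT) (mpow 3) ipow3.
have [_ e4] := expect_lab j (pcn 0) (ic 0 isT) (mpow 4) ipow4.
have -> : (fun t => coord k.+1 j t ^+ 4) = (fun t => coord k j t ^+ 4 +
    (4 * (Ri k t * ((lab k t == j)%:R * coord k j t ^+ 3)) +
    (6 * (Ri k t ^+ 2 * ((lab k t == j)%:R * coord k j t ^+ 2)) +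
    (4 * (Ri k t ^+ 3 * ((lab k t == j)%:R * coord k j t ^+ 1)) +
    Ri k t ^+ 4 * ((lab k t == j)%:R * coord k j t ^+ 0))))).
  by apply/funext => t; rewrite coordS; case: (_ == _) => /=; ring.
have tt n m : (n + m)%N = 4%N -> tame 4 (fun t => Ri k t ^+ n * ((lab k t == j)%:R * coord k j t ^+ m)).
  by move=> <-; apply: tameM; [have := tameX n tR; rewrite muln1|exact: (tameM tl (tcn m))].
have t1 : tame 4 (fun t => Ri k t * ((lab k t == j)%:R * coord k j t ^+ 3)) by exact: (tt 1 3).
have t2 := tt 2 2 erefl; have t3 := tt 3 1 erefl; have t4 := tt 4 0 erefl.
rewrite expectD//; last by do !(apply: tameD => //; first exact: tameZ).
rewrite expectD//; [|exact: tameZ|by do !(apply: tameD => //; first exact: tameZ)].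
rewrite expectD//; [|exact: tameZ|by do !(apply: tameD => //; first exact: tameZ)].
rewrite expectD//; last exact: tameZ.
rewrite !expectZ// e1 e2 e3 e4 IH// ER1 ER2 expect_coord2//.
have -> : \int[P]_t (coord k j t ^+ 1) = 0 by exact: (expect_coord j kN').
have -> : \int[P]_t (coord k j t ^+ 0) = 1 by exact: (Rintegral_cstT P 1).
rewrite -/m3 -/m4 -natr1.
by field; rewrite pnatr_eq0.
Qed.

Lemma expect_total2 k : (k <= N)%N -> \int[P]_t (total k t ^+ 2) = k%:R.
Proof.
elim: k => [|k IH] kN.
  by under eq_Rintegral do rewrite /total big_ord0 expr0n; rewrite Rintegral_cstT.
have kN' := ltnW kN; have tt := tame_total kN'; have tR := tame_R kN.
have it : P.-integrable setT (EFin \o total k) by apply: tame_integrable; exact: tameW tt.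
have [_ e1] := expect_stepR (@past_total k) it (@measurable_id _ _ _) ipow1.
have [_ e2] := @expect_stepR k (fun=> 1) (fun x => x ^+ 2) (measurable_cst _)
  (integrable_cstT P 1) (mpow 2) ipow2.
have -> : (fun t => total k.+1 t ^+ 2) = (fun t => total k t ^+ 2 +
    (2 * (total k t * Ri k t) + 1 * Ri k t ^+ 2)).
  by apply/funext => t; rewrite /total big_ord_recr/=; ring.
have t1 : tame 4 (fun t => total k t * Ri k t) by apply: tameW (tameM tt tR).
have t2 : tame 4 (fun t => 1 * Ri k t ^+ 2) by apply: tameZ; apply: tameW (tameX 2 tR).
rewrite expectD; [|by apply: tameW (tameX 2 tt)|by apply: tameD => //; exact: tameZ].
rewrite expectD//; last exact: tameZ.
by rewrite expectZ// e1 e2 IH// ER1 ER2 mulr0 mulr0 add0r Rintegral_cstT mulr1 natr1.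
Qed.

Lemma expect_total k : (k <= N)%N -> \int[P]_t total k t = 0.
Proof.
move=> kN; under eq_Rintegral do rewrite -sum_coord.
have [_ ->] := @Rintegral_sum _ _ _ P _ (index_enum 'I_d) (coord k)
  (fun j => tame_integrable (tameW (isT : (1 <= 4)%N) (tame_coord j kN))).
by apply: big1 => j _; exact: expect_coord.
Qed.

Lemma expect_sqnorm k : (k <= N)%N -> \int[P]_t sqnorm k t = k%:R.
Proof.
move=> kN; have [_ ->] := @Rintegral_sum _ _ _ P _ (index_enum 'I_d) (fun j t => coord k j t ^+ 2)
  (fun j => tame_integrable (tameW (isT : (2 <= 4)%N) (tameX 2 (tame_coord j kN)))).
rewrite (eq_bigr _ (fun j _ => expect_coord2 j kN)) sumr_const card_ord.
by rewrite -[LHS]mulr_natr divfK// pnatr_eq0.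
Qed.

(** The martingale property, tested against the past: both R^2 - 1 and R are centered. X and
    [incr k] have degree 2 each, so their product has the degree 4 that ensures integrability. *)
Lemma expect_incr k X : (k < N)%N -> past k k X -> tame 2 X ->
  \int[P]_t (X t * incr k t) = 0.
Proof.
move=> kN pX tX; have kN' := ltnW kN; have tR := tame_R kN.
have iX : P.-integrable setT (EFin \o X) by apply: tame_integrable; exact: tameW tX.
have [_ e1] := expect_stepR pX iX mcen icen.
have pF j : past k k (fun t => X t * coord k j t) by apply: measurable_funM => //; exact: past_coord.
have tF j := tameM tX (tame_coord j kN').
have iF j : P.-integrable setT (EFin \o (fun t => X t * coord k j t)).
  by apply: tame_integrable; exact: tameW (tF j).
have [_ e2] := expect_step pF iF (@measurable_id _ _ _) ipow1.
have -> : (fun t => X t * incr k t) = (fun t => X t * (Ri k t ^+ 2 - 1) +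
    2 * (Ri k t * (X t * sel k t))).
  by apply/funext => t; rewrite /incr; ring.
rewrite expectD.
- rewrite expectZ; first by rewrite e1 e2 Ecen ER1 mulr0 mul0r mulr0 addr0.
  by have := tameM tR (tameM tX (tame_sel kN')); apply: tameW.
- apply: (tameM tX); apply: tameB; first exact: (tameX 2 tR).
  by apply: (@tameW 0) => //; exact: tame_cst.
- by apply: tameZ; have := tameM tR (tameM tX (tame_sel kN')); apply: tameW.
Qed.

(** The conditional variance of the increment, tested against the past. Averaging over the label
    turns [coord] into [total] / d and its square into [sqnorm] / d. X has degree 0 since
    [incr k t ^+ 2] already has degree 4. *)
Lemma expect_incr2 k X : (k < N)%N -> past k k X -> tame 0 X ->
  \int[P]_t (X t * incr k t ^+ 2) = beta * \int[P]_t X t +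
  4 / d%:R * (m3 * \int[P]_t (X t * total k t) + \int[P]_t (X t * sqnorm k t)).
Proof.
move=> kN pX tX; have kN' := ltnW kN; have tR := tame_R kN; have ts := tame_sel kN'.
have iX : P.-integrable setT (EFin \o X) by apply: tame_integrable; exact: tameW tX.
have [_ e1] := expect_stepR pX iX mcen2 icen2.
have pF j : past k k (fun t => X t * coord k j t) by apply: measurable_funM => //; exact: past_coord.
have tF j := tameM tX (tame_coord j kN').
have iF j : P.-integrable setT (EFin \o (fun t => X t * coord k j t)).
  by apply: tame_integrable; exact: tameW (tF j).
have [_ e2] := expect_step pF iF mcenx icenx.
have pG j : past k k (fun t => X t * coord k j t ^+ 2).
  by apply: measurable_funM => //; apply: measurable_funX; exact: past_coord.
have tG j := tameM tX (tameX 2 (tame_coord j kN')).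
have iG j : P.-integrable setT (EFin \o (fun t => X t * coord k j t ^+ 2)).
  by apply: tame_integrable; exact: tameW (tG j).
have [_ e3] := expect_step pG iG (mpow 2) ipow2.
have tc : tame 2 (fun t => Ri k t ^+ 2 - 1).
  apply: tameB; first exact: (tameX 2 tR).
  by apply: (@tameW 0) => //; exact: tame_cst.
have t1 : tame 4 (fun t => X t * (Ri k t ^+ 2 - 1) ^+ 2) by exact: (tameM tX (tameX 2 tc)).
have t2 : tame 4 (fun t => (Ri k t ^+ 3 - Ri k t) * (X t * sel k t)).
  apply: (@tameM 3 1); last exact: (tameM tX ts).
  apply: tameB; first exact: (tameX 3 tR).
  by apply: tameW tR.
have t3 : tame 4 (fun t => Ri k t ^+ 2 * (X t * sel k t ^+ 2)).
  exact: (tameM (tameX 2 tR) (tameM tX (tameX 2 ts))).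
have -> : (fun t => X t * incr k t ^+ 2) = (fun t => X t * (Ri k t ^+ 2 - 1) ^+ 2 +
    (4 * ((Ri k t ^+ 3 - Ri k t) * (X t * sel k t)) +
     4 * (Ri k t ^+ 2 * (X t * sel k t ^+ 2)))).
  by apply/funext => t; rewrite /incr; ring.
rewrite expectD//; last by apply: tameD; exact: tameZ.
rewrite expectD; [|exact: tameZ|exact: tameZ].
rewrite !expectZ// e1 e2 e3 Ecenx ER2 -/beta.
have sF : \sum_j \int[P]_t (X t * coord k j t) = \int[P]_t (X t * total k t).
  rewrite -(@Rintegral_sum _ _ _ P _ (index_enum 'I_d) _ iF).2.
  by apply: eq_Rintegral => t _; rewrite -big_distrr/= sum_coord.
have sG : \sum_j \int[P]_t (X t * coord k j t ^+ 2) = \int[P]_t (X t * sqnorm k t).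
  rewrite -(@Rintegral_sum _ _ _ P _ (index_enum 'I_d) _ iG).2.
  by apply: eq_Rintegral => t _; rewrite -big_distrr.
rewrite sF sG; ring.
Qed.

Definition centered k t := sqnorm k t - k%:R.

Lemma centeredS k t : centered k.+1 t = centered k t + incr k t.
Proof. by rewrite /centered sqnormS -natr1; ring. Qed.

Lemma past_centered k : past k k (centered k).
Proof. by apply: measurable_funB => //; exact: past_sqnorm. Qed.

Lemma tame_centered k : (k <= N)%N -> tame 2 (centered k).
Proof.
move=> kN; apply: tameB; first exact: tame_sqnorm.
by apply: (@tameW 0) => //; exact: tame_cst.
Qed.

(** Martingale increments are orthogonal, so step k adds its own second moment beta + 4 k / d, which
    is [expect_incr2] with X = 1. *)
Lemma expect_centered2 k : (k <= N)%N ->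
  \int[P]_t (centered k t ^+ 2) = k%:R * beta + 2 * k%:R * (k%:R - 1) / d%:R.
Proof.
elim: k => [|k IH] kN.
  have -> : (fun t => centered 0 t ^+ 2) = (fun=> 0).
    apply/funext => t; rewrite /centered /sqnorm big1 ?subr0 ?expr0n// => j _.
    by rewrite coord0 expr0n.
  by rewrite Rintegral_cstT !mul0r mulr0 !mul0r addr0.
have kN' := ltnW kN; have tc := tame_centered kN'; have ti := tame_incr kN.
have e1 := expect_incr kN (@past_centered k) tc.
have e2 := expect_incr2 kN (measurable_cst (1 : K)) (tame_cst 1).
have -> : (fun t => centered k.+1 t ^+ 2) = (fun t => centered k t ^+ 2 +
    (2 * (centered k t * incr k t) + 1 * incr k t ^+ 2)).
  by apply/funext => t; rewrite centeredS; ring.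
have t1 : tame 4 (fun t => centered k t * incr k t) by exact: (tameM tc ti).
have t2 : tame 4 (fun t => 1 * incr k t ^+ 2) by apply: tameZ; exact: (tameX 2 ti).
rewrite expectD; [|exact: (tameX 2 tc)|by apply: tameD => //; exact: tameZ].
rewrite expectD//; last exact: tameZ.
rewrite expectZ// e1 e2 IH// Rintegral_cstT.
under [X in m3 * X]eq_Rintegral do rewrite mul1r.
under [X in _ + (_ + _ * (_ + X))]eq_Rintegral do rewrite mul1r.
rewrite expect_total// expect_sqnorm// -natr1.
by field; rewrite pnatr_eq0.
Qed.

(** * Exchanging one step for variance, and telescoping *)

Section lindeberg.
Variables (w0 C c a e : K).
Hypothesis w0_gt0 : 0 < w0.
Hypothesis C_ge0 : 0 <= C.
Hypothesis gaussC : forall w x : K, w0 <= w ->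
  [/\ gauss w x <= C, `|gauss1 w x| <= C & `|gauss2 w x| <= C].
Hypothesis gaussT : forall w x h v : K, w0 <= w -> 0 <= v ->
  `|gauss w (x + h) - gauss (w + v) x - h * gauss1 w x - (h ^+ 2 - v) / 2 * gauss2 w x|
  <= C * (h ^+ 2 * Num.min 1 `|h| + v ^+ 2).
Hypothesis c_gt0 : 0 < c.
Hypothesis e_gt0 : 0 < e.

Let n' : K := N%:R.
Let D : K := d%:R.

Let vstep k : K := (beta + 4 * k%:R / D) / c ^+ 2.

Let tailR := \int[P0]_w ((R w ^+ 2 - 1) ^+ 2 *
  \1_[set y | e / 2 < `|y|] ((R w ^+ 2 - 1) / c)).

Let D_gt0 : 0 < D. Proof. by rewrite ltr0n. Qed.

Let beta_ge0 : 0 <= beta.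
Proof. by apply: Rintegral_ge0 => w _; exact: sqr_ge0. Qed.

Let m4_ge0 : 0 <= m4.
Proof. by apply: Rintegral_ge0 => w _; exact: exprn_even_ge0. Qed.

Let x k t := centered k t / c - a.

Let past_x k : past k k (x k).
Proof. by apply: measurable_funB => //; apply: measurable_funM => //; exact: past_centered. Qed.

Let mgauss1 (w : K) : measurable_fun setT (gauss1 w).
Proof.
rewrite (_ : gauss1 w = (fun y => - (y * w^-1) * gauss w y))//.
apply: measurable_funM; last exact: measurable_gauss.
by apply: measurableT_comp => //; exact: measurable_funM.
Qed.

Let mgauss2 (w : K) : measurable_fun setT (gauss2 w).
Proof.
rewrite (_ : gauss2 w = (fun y => (y ^+ 2 * (w ^+ 2)^-1 - w^-1) * gauss w y))//.
apply: measurable_funM; last exact: measurable_gauss.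
apply: measurable_funB => //; apply: measurable_funM => //.
Qed.

(** With [sqnorm] = [centered] + k in [expect_incr2], subtracting v cancels the deterministic part
    of the conditional variance. There remains 2 / (c^2 D) times the expectation of [G] against m3
    [total] + [centered], bounded by C and the L^1 norms that [abs_moment_le] derives from second
    moments. *)
Let main_term k (w v : K) : (k < N)%N -> w0 <= w -> v = vstep k ->
  `|\int[P]_t (((incr k t / c) ^+ 2 - v) / 2 * gauss2 w (x k t))| <=
  2 * C / (c ^+ 2 * D) * (`|m3| * Num.sqrt n' + Num.sqrt (n' * beta + 2 * n' ^+ 2 / D)).
Proof.
move=> kN w0w vE; have kN' := ltnW kN.
pose G t := gauss2 w (x k t).
have pG : past k k G by exact: (measurableT_comp (mgauss2 w) (@past_x k)).
have mG := past_measurable pG.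
have GC t : `|G t| <= C by have [] := gaussC (x k t) w0w.
have tG : tame 0 G by apply: (@tame_bounded _ C).
have ti := tame_incr kN; have tt := tame_total kN'; have tc := tame_centered kN'.
have t2 : tame 4 (fun t => G t * incr k t ^+ 2) by exact: (tameM tG (tameX 2 ti)).
have tG4 : tame 4 G by exact: tameW tG.
have -> : (fun t => ((incr k t / c) ^+ 2 - v) / 2 * gauss2 w (x k t)) =
    (fun t => (2 * c ^+ 2)^-1 * (G t * incr k t ^+ 2) + - (v / 2) * G t).
  by apply/funext => t; rewrite /G; field; rewrite gt_eqF.
rewrite expectD; [|exact: tameZ|exact: tameZ].
rewrite !expectZ// expect_incr2//.
have tGt : tame 4 (fun t => G t * total k t) by apply: tameW (tameM tG tt).
have tGs : tame 4 (fun t => G t * sqnorm k t) by apply: tameW (tameM tG (tame_sqnorm kN')).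
have tGc : tame 4 (fun t => G t * centered k t) by apply: tameW (tameM tG tc).
have EGs : \int[P]_t (G t * sqnorm k t) = \int[P]_t (G t * centered k t) + k%:R * \int[P]_t G t.
  rewrite -expectZ// -expectD//; last exact: tameZ.
  by apply: eq_Rintegral => t _; rewrite /centered; ring.
have -> : (2 * c ^+ 2)^-1 * (beta * \int[P]_t G t + 4 / d%:R *
      (m3 * \int[P]_t (G t * total k t) + \int[P]_t (G t * sqnorm k t))) +
    - (v / 2) * \int[P]_t G t =
    2 / (c ^+ 2 * D) * (m3 * \int[P]_t (G t * total k t) + \int[P]_t (G t * centered k t)).
  rewrite EGs vE /vstep /D; field.
  by rewrite pnatr_eq0/= gt_eqF.
have bnd X q : tame 2 X -> \int[P]_t (X t ^+ 2) <= q ->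
    tame 4 (fun t => G t * X t) -> `|\int[P]_t (G t * X t)| <= C * Num.sqrt q.
  move=> tX Xq tGX.
  have [iX aX] := abs_moment_le tX.1 (tame_integrable (tameX 2 tX)) Xq.
  apply: (le_trans (le_normr_Rintegral measurableT (tame_integrable tGX))).
  apply: (@le_trans _ _ (C * \int[P]_t `|X t|)); last by rewrite ler_wpM2l.
  rewrite -RintegralZl//; apply: le_Rintegral => //.
  - exact: (integrable_norm (tame_integrable tGX)).
  - exact: (integrableZl measurableT C iX).
  - by move=> t _; rewrite normrM ler_wpM2r.
have b1 : `|\int[P]_t (G t * total k t)| <= C * Num.sqrt n'.
  apply: bnd => //; first exact: tameW tt.
  by rewrite expect_total2// ler_nat.
have b2 : `|\int[P]_t (G t * centered k t)| <= C * Num.sqrt (n' * beta + 2 * n' ^+ 2 / D).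
  apply: bnd => //; rewrite expect_centered2// lerD//.
    by rewrite ler_wpM2r// ler_nat.
  rewrite ler_wpM2r ?invr_ge0 ?(ltW D_gt0)// -mulrA ler_wpM2l// expr2.
  have k0 : 0 <= k%:R :> K by [].
  have kn : k%:R <= n' by rewrite ler_nat.
  apply: (@le_trans _ _ (k%:R * k%:R)); first by rewrite ler_wpM2l// gerBl.
  by rewrite ler_pM.
have c2D : 0 <= 2 / (c ^+ 2 * D).
  by apply: divr_ge0 => //; apply: mulr_ge0; [exact: sqr_ge0|exact: ltW].
rewrite normrM (ger0_norm c2D).
have -> : 2 * C / (c ^+ 2 * D) = 2 / (c ^+ 2 * D) * C by ring.
rewrite -[leRHS]mulrA ler_wpM2l// mulrDr (le_trans (ler_normD _ _))// lerD//.
by rewrite normrM mulrCA ler_wpM2l.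
Qed.

Let vmax := (beta + 4 * n' / D) / c ^+ 2.

Let remainder := 2 * e * vmax + 4 * tailR / c ^+ 2 +
  256 * m4 * (n' * m4 / D + 3 * n' ^+ 2 / D ^+ 2) / (c ^+ 4 * e ^+ 2).

Let u k t := (Ri k t ^+ 2 - 1) / c.
Let s k t := 2 * (Ri k t * sel k t) / c.

(** [H] is the majorant of [square_min_bound] with a = [u] and b = [s]. Its last term is where the
    fourth moment of a coordinate enters. *)
Let remainder_term k : (k < N)%N ->
  let H t := 2 * e * (u k t ^+ 2 + s k t ^+ 2) +
    4 * (u k t ^+ 2 * \1_[set y | e / 2 < `|y|] (u k t)) + 16 / e ^+ 2 * s k t ^+ 4 in
  P.-integrable setT (EFin \o H) /\ \int[P]_t H t <= remainder.
Proof.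
move=> kN H; have kN' := ltnW kN; have tR := tame_R kN; have ts := tame_sel kN'.
have kn : k%:R <= n' by rewrite ler_nat.
have k0 : 0 <= k%:R :> K by [].
have cn0 : c != 0 by rewrite gt_eqF.
have [iu eu] := same_law_Rintegral k mcen2 icen2.
have mtail : measurable_fun setT (fun y : K => (y ^+ 2 - 1) ^+ 2 *
    \1_[set y | e / 2 < `|y|] ((y ^+ 2 - 1) / c)).
  apply: measurable_funM => //.
  apply: (measurableT_comp (measurable_indic (measurable_tail _))).
  exact: measurable_funM.
have itail : P0.-integrable setT (EFin \o ((fun y : K => (y ^+ 2 - 1) ^+ 2 *
    \1_[set y | e / 2 < `|y|] ((y ^+ 2 - 1) / c)) \o R)).
  apply: (integrable_dominated _ icen2); first by apply: (measurableT_comp mtail).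
  move=> w /=; rewrite ger0_norm.
    by rewrite ler_piMr ?sqr_ge0// indicE; case: (_ \in _).
  by rewrite mulr_ge0 ?sqr_ge0// indicE; case: (_ \in _).
have [iT eT] := same_law_Rintegral k mtail itail.
have [i2 e2] := expect_step (fun j => measurable_funX 2 (@past_coord k j))
  (fun j => tame_integrable (tameW (isT : (2 <= 4)%N) (tameX 2 (tame_coord j kN'))))
  (mpow 2) ipow2.
have [i4 e4] := expect_step (fun j => measurable_funX 4 (@past_coord k j))
  (fun j => tame_integrable (tameX 4 (tame_coord j kN'))) (mpow 4) ipow4.
have e2' : \int[P]_t (Ri k t ^+ 2 * sel k t ^+ 2) = k%:R / D.
  rewrite e2 ER2 mul1r (eq_bigr _ (fun j _ => expect_coord2 j kN')) sumr_const card_ord.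
  have -> : (k%:R / d%:R : K) *+ d = k%:R by rewrite -[LHS]mulr_natr divfK ?pnatr_eq0.
  by [].
have e4' : \int[P]_t (Ri k t ^+ 4 * sel k t ^+ 4) <=
    m4 * (n' * m4 / D + 3 * n' ^+ 2 / D ^+ 2).
  rewrite e4 -/m4 ler_wpM2l// ler_pdivrMr//.
  apply: (@le_trans _ _ (\sum_(j < d) (n' * m4 / D + 3 * n' ^+ 2 / D ^+ 2))); last first.
    by rewrite sumr_const card_ord mulr_natr.
  apply: ler_sum => j _; apply: (le_trans (expect_coord4 j kN')).
  apply: lerD.
    by rewrite ler_wpM2r ?invr_ge0 ?(ltW D_gt0)// ler_wpM2r.
  by rewrite ler_wpM2r ?invr_ge0 ?exprn_ge0 ?(ltW D_gt0)// ler_wpM2l// lerXn2r ?nnegrE.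
(* 8 = 2 * 2^2 and 256 = 16 * 2^4 come from the factor 2 in [s]. *)
have HE : H = (fun t => (2 * e / c ^+ 2 * (Ri k t ^+ 2 - 1) ^+ 2 +
    8 * e / c ^+ 2 * (Ri k t ^+ 2 * sel k t ^+ 2)) +
    (4 / c ^+ 2 * ((Ri k t ^+ 2 - 1) ^+ 2 * \1_[set y | e / 2 < `|y|] ((Ri k t ^+ 2 - 1) / c)) +
    256 / (c ^+ 4 * e ^+ 2) * (Ri k t ^+ 4 * sel k t ^+ 4))).
  by apply/funext => t; rewrite /H /u /s; field; rewrite cn0 gt_eqF.
have j1 := integrableZl measurableT (2 * e / c ^+ 2) iu.
have j2 := integrableZl measurableT (8 * e / c ^+ 2) i2.
have j3 := integrableZl measurableT (4 / c ^+ 2) iT.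
have j4 := integrableZl measurableT (256 / (c ^+ 4 * e ^+ 2)) i4.
have j12 := integrableD measurableT j1 j2.
have j34 := integrableD measurableT j3 j4.
rewrite HE; split; first exact: (integrableD measurableT j12 j34).
rewrite (RintegralD measurableT j12 j34) (RintegralD measurableT j1 j2) (RintegralD measurableT j3 j4).
rewrite (RintegralZl _ measurableT iu) (RintegralZl _ measurableT i2).
rewrite (RintegralZl _ measurableT iT) (RintegralZl _ measurableT i4) eu eT e2' -/beta -/tailR.
rewrite /remainder /vmax addrA lerD//.
  rewrite lerD//; last by rewrite le_eqVlt; apply/orP; left; apply/eqP; ring.
  have -> : 2 * e / c ^+ 2 * beta + 8 * e / c ^+ 2 * (k%:R / D) =
      2 * e * ((beta + 4 * k%:R / D) / c ^+ 2) by field; rewrite cn0 gt_eqF.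
  rewrite ler_wpM2l ?mulr_ge0 ?(ltW e_gt0)// ler_wpM2r ?invr_ge0 ?sqr_ge0// lerD2l.
  by rewrite ler_wpM2r ?invr_ge0 ?(ltW D_gt0)// ler_wpM2l.
have -> : 256 * m4 * (n' * m4 / D + 3 * n' ^+ 2 / D ^+ 2) / (c ^+ 4 * e ^+ 2) =
  256 / (c ^+ 4 * e ^+ 2) * (m4 * (n' * m4 / D + 3 * n' ^+ 2 / D ^+ 2)) by ring.
rewrite ler_wpM2l//; apply: divr_ge0 => //.
by apply: mulr_ge0; apply: exprn_ge0; exact: ltW.
Qed.

Let step_bound := 2 * C / (c ^+ 2 * D) *
    (`|m3| * Num.sqrt n' + Num.sqrt (n' * beta + 2 * n' ^+ 2 / D)) +
  C * (remainder + vmax ^+ 2).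

Let vstep_ge0 k : 0 <= vstep k.
Proof.
apply: divr_ge0; last exact: sqr_ge0.
by apply: addr_ge0 => //; apply: divr_ge0; [exact: mulr_ge0|exact: ltW].
Qed.

Let vstep_le k : (k < N)%N -> vstep k <= vmax.
Proof.
move=> kN; rewrite /vstep /vmax ler_wpM2r ?invr_ge0 ?sqr_ge0// lerD2l.
by rewrite ler_wpM2r ?invr_ge0 ?(ltW D_gt0)// ler_wpM2l// ler_nat ltnW.
Qed.

(** [gauss_taylor] is used at [x k t] with h = [incr k t / c]. The first-order term has mean zero by
    [expect_incr], the second-order term is [main_term], and the remainder is bounded by
    [remainder_term] and v^2. *)
Let lindeberg_step k (w : K) : (k < N)%N -> w0 <= w ->
  `|\int[P]_t gauss w (x k.+1 t) - \int[P]_t gauss (w + vstep k) (x k t)| <= step_bound.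
Proof.
move=> kN w0w; have kN' := ltnW kN; set v := vstep k.
have v0 : 0 <= v by exact: vstep_ge0.
have w0wv : w0 <= w + v by rewrite ler_wpDr.
have cn0 : c != 0 by rewrite gt_eqF.
have xS t : x k.+1 t = x k t + incr k t / c.
  by rewrite /x centeredS; field.
have tG w' m : w0 <= w' -> (m <= N)%N -> tame 4 (fun t => gauss w' (x m t)).
  move=> ww mN; apply: (@tameW 0) => //; apply: (@tame_bounded _ C).
    exact: (measurableT_comp (measurable_gauss w') (past_measurable (@past_x m))).
  by move=> t; rewrite ger0_norm ?gauss_ge0//; have [] := gaussC (x m t) ww.
have t0 := tG _ _ w0w kN; have t1 := tG _ _ w0wv kN'.
have tG1 : tame 0 (fun t => c^-1 * gauss1 w (x k t)).
  apply: tameZ; apply: (@tame_bounded _ C).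
    exact: (measurableT_comp (mgauss1 w) (past_measurable (@past_x k))).
  by move=> t; have [] := gaussC (x k t) w0w.
have pG1 : past k k (fun t => c^-1 * gauss1 w (x k t)).
  by apply: measurable_funM => //; exact: (measurableT_comp (mgauss1 w) (@past_x k)).
have tG2 : tame 0 (fun t => gauss2 w (x k t)).
  apply: (@tame_bounded _ C).
    exact: (measurableT_comp (mgauss2 w) (past_measurable (@past_x k))).
  by move=> t; have [] := gaussC (x k t) w0w.
have ti := tame_incr kN.
have t2 : tame 4 (fun t => c^-1 * gauss1 w (x k t) * incr k t) by apply: tameW (tameM tG1 ti).
have t3 : tame 4 (fun t => ((incr k t / c) ^+ 2 - v) / 2 * gauss2 w (x k t)).
  have -> : (fun t => ((incr k t / c) ^+ 2 - v) / 2 * gauss2 w (x k t)) =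
      (fun t => ((2 * c ^+ 2)^-1 * incr k t ^+ 2 - v / 2) * gauss2 w (x k t)).
    by apply/funext => t; field.
  apply: (@tameM 4 0) => //; apply: tameB; first by apply: tameZ; exact: (tameX 2 ti).
  by apply: (@tameW 0) => //; exact: tame_cst.
have [iH HR] := remainder_term kN.
set H := (X in P.-integrable setT (EFin \o X)) in iH.
have iHv : P.-integrable setT (EFin \o (fun t => H t + v ^+ 2)).
  exact: (integrableD measurableT iH (integrable_cstT P (v ^+ 2))).
have iB : P.-integrable setT (EFin \o (fun t => C * (H t + v ^+ 2))).
  exact: (integrableZl measurableT C iHv).
have t123 : tame 4 (fun t => gauss (w + v) (x k t) + (c^-1 * gauss1 w (x k t) * incr k t +
    ((incr k t / c) ^+ 2 - v) / 2 * gauss2 w (x k t))).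
  by apply: tameD => //; exact: tameD.
have := Rintegral_dist (tame_integrable t0) (tame_integrable t123) iB.
rewrite expectD//; last exact: tameD.
rewrite expectD// expect_incr//; last exact: tameW tG1.
rewrite add0r.
have /= EB : \int[P]_t (C * (H t + v ^+ 2)) <= C * (remainder + vmax ^+ 2).
  rewrite RintegralZl// ler_wpM2l// RintegralD//; last exact: integrable_cstT.
  rewrite Rintegral_cstT lerD// lerXn2r ?nnegrE//; last exact: vstep_le.
  exact: le_trans (vstep_le kN).
have M := main_term kN w0w (erefl v).
move=> /(_ _)/le_trans/(_ EB) => HB.
have {}HB := HB _.
set A := \int[P]_t gauss w _; set B := \int[P]_t gauss (w + v) _.
set E2 := \int[P]_t _ in M HB.
have -> : A - B = E2 + (A - (B + E2)) by ring.
rewrite (le_trans (ler_normD _ _))// lerD//; apply: HB => t.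
rewrite xS.
have := gaussT (x k t) (incr k t / c) w0w v0.
have -> : gauss w (x k t + incr k t / c) - (gauss (w + v) (x k t) +
   (c^-1 * gauss1 w (x k t) * incr k t + ((incr k t / c) ^+ 2 - v) / 2 * gauss2 w (x k t))) =
   gauss w (x k t + incr k t / c) - gauss (w + v) (x k t) - incr k t / c * gauss1 w (x k t) -
   ((incr k t / c) ^+ 2 - v) / 2 * gauss2 w (x k t) by ring.
move=> /le_trans; apply; rewrite ler_wpM2l// lerD2r.
have -> : incr k t / c = u k t + s k t by rewrite /u /s /incr; ring.
exact: square_min_bound.
Qed.

Lemma lindeberg_bound :
  `|\int[P]_t gauss w0 (centered N t / c - a) -
    gauss (w0 + (n' * beta + 2 * n' * (n' - 1) / D) / c ^+ 2) a| <=
  lindeberg_error C c e n' D m3 m4 beta tailR.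
Proof.
(* [W k] is the variance of the steps still to come. The kernel parameter w0 + [W k] decreases to w0
   at time N, while at time 0 the walk is deterministic and the kernel carries the full variance. *)
pose W k := \sum_(k <= i < N) vstep i.
have W0 k : 0 <= W k by apply: sumr_ge0 => i _; exact: vstep_ge0.
have VE : W 0%N = (n' * beta + 2 * n' * (n' - 1) / D) / c ^+ 2.
  have gen m : \sum_(0 <= i < m) vstep i =
      (m%:R * beta + 2 * m%:R * (m%:R - 1) / D) / c ^+ 2.
    elim: m => [|m IH]; first by rewrite big_nil !mul0r mulr0 !mul0r addr0 mul0r.
    rewrite big_nat_recr//= IH /vstep -natr1; field.
    by rewrite (gt_eqF D_gt0) (gt_eqF c_gt0).
  exact: gen.
have claim k : (k <= N)%N ->
    `|\int[P]_t gauss (w0 + W k) (x k t) - gauss (w0 + W 0%N) a| <= k%:R * step_bound.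
  elim: k => [|k IH] kN.
    have -> : (fun t => gauss (w0 + W 0%N) (x 0 t)) = (fun=> gauss (w0 + W 0%N) a).
      apply/funext => t; rewrite /x /centered /sqnorm big1 ?subr0 ?mul0r ?sub0r ?gaussN//.
      by move=> j _; rewrite coord0 expr0n.
    by rewrite Rintegral_cstT subrr normr0 mul0r.
  have WE : w0 + W k = w0 + W k.+1 + vstep k by rewrite /W (big_ltn kN); ring.
  have := lindeberg_step kN (_ : w0 <= w0 + W k.+1).
  rewrite lerDl W0 -WE => /(_ isT) h1.
  have h2 := IH (ltnW kN).
  set A := \int[P]_t _ in h1 *; set B := \int[P]_t _ in h1 h2.
  have -> : A - gauss (w0 + W 0%N) a = (A - B) + (B - gauss (w0 + W 0%N) a) by ring.
  by rewrite -natr1 mulrDl mul1r (le_trans (ler_normD _ _))// [leRHS]addrC lerD.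
have := claim N (leqnn N); rewrite /lindeberg_error -/step_bound.
by rewrite /W big_geq// addr0 -/(W 0%N) VE.
Qed.

End lindeberg.

(** * Return to the Euclidean norm of the walk *)

Lemma enorm_walk_sqnorm k t : (forall i, basis (V i t)) ->
  enorm (walk Ri V k t) ^+ 2 = sqnorm k t.
Proof.
move=> bV; rewrite /enorm sqr_sqrtr ?sumr_ge0//; last by move=> j _; exact: sqr_ge0.
apply: eq_bigr => j _; congr (_ ^+ 2).
rewrite /walk summxE; apply: eq_bigr => i _.
by rewrite /increment mxE {1}((basisP _).1 (bV i)) mxE eqxx/= eq_sym.
Qed.

(** The label walk and the true walk agree outside the countable union of the null events where some
    V_i misses the basis. *)
Lemma Rintegral_walk k (h : K -> K) : measurable_fun setT h ->
  \int[P]_t h (enorm (walk Ri V k t) ^+ 2) = \int[P]_t h (sqnorm k t).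
Proof.
move=> mh; congr fine; apply: ae_eq_integral => //.
- apply/measurable_EFinP; apply: (measurableT_comp mh); apply: measurable_funX.
  exact: measurable_enorm_walk.
- apply/measurable_EFinP; apply: (measurableT_comp mh).
  exact: past_measurable (@past_sqnorm k).
- have neg : P.-negligible (\bigcup_i ~` (V i @^-1` @basis K d')).
    apply: negligible_bigcup => i.
    have mB : measurable (V i @^-1` @basis K d').
      by rewrite -[X in measurable X]setTI; apply: measurable_funPT => //; exact: basis_measurable.
    apply/negligibleP; first exact: measurableC.
    by rewrite [LHS](probability_setC P mB) (prob_basis (V_law i)) subee.
  apply: negligibleS neg => t /=.
  apply: contra_notP => nN _; congr EFin; congr h; apply: enorm_walk_sqnorm => i.
  by apply: contrapT => nb; apply: nN; exists i.
Qed.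

Lemma tail_walk (c M : K) : 0 < c -> 0 < M ->
  \int[P]_t \1_[set y | M < `|y|] ((enorm (walk Ri V N t) ^+ 2 - N%:R) / c) <=
  (N%:R * beta + 2 * N%:R * (N%:R - 1) / d%:R) / c ^+ 2 / M ^+ 2.
Proof.
move=> c0 M0; have cn0 : c != 0 by rewrite gt_eqF.
have Mn0 : M != 0 by rewrite gt_eqF.
have mI : measurable_fun setT (\1_[set y | M < `|y|] : K -> K).
  exact: (measurable_indic (measurable_tail M)).
pose h y : K := \1_[set y | M < `|y|] ((y - N%:R) / c).
have mh : measurable_fun setT h.
  apply: (measurableT_comp mI); apply: measurable_funM => //.
  exact: measurable_funB.
rewrite (Rintegral_walk N mh) -expect_centered2//.
have tc := tame_centered (leqnn N).
have -> : \int[P]_t (centered N t ^+ 2) / c ^+ 2 / M ^+ 2 =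
    \int[P]_t ((c ^+ 2)^-1 * (M ^+ 2)^-1 * centered N t ^+ 2).
  by rewrite expectZ; [ring|exact: (tameX 2 tc)].
apply: le_Rintegral => //.
- apply: (@bounded_integrable _ _ _ P _ 1).
    by apply: (measurableT_comp mh); exact: past_measurable (@past_sqnorm N).
  by move=> t; rewrite /h indicE ger0_norm//; case: (_ \in _).
- by apply: tame_integrable; apply: tameZ; exact: (tameX 2 tc).
- move=> t _; rewrite /h indicE.
  have -> : (c ^+ 2)^-1 * (M ^+ 2)^-1 * centered N t ^+ 2 = (centered N t / c) ^+ 2 / M ^+ 2.
    by field; rewrite cn0 Mn0.
  case: (boolP (_ \in _)) => [|_]; last by rewrite divr_ge0// sqr_ge0.
  rewrite inE/= => MX; rewrite ler_pdivlMr ?exprn_gt0// mul1r.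
  rewrite -(real_normK (num_real (centered N t / c))) lerXn2r ?nnegrE ?(ltW M0)//.
  exact: ltW.
Qed.

End tame.
End model.

(** In terms of x = n / c^2 and y = n^2 / (c^2 D), both at most B, every summand of the error
    acquires a factor that will vanish, except the one proportional to e. *)
Lemma lindeberg_error_le (K : realType) (C c e n D m3 m4 beta tail B : K) :
  0 <= C -> 0 < c -> 0 < e -> 0 < n -> 0 < D -> 0 <= m4 -> 0 <= beta -> 0 <= tail ->
  n / c ^+ 2 <= B -> n ^+ 2 / (c ^+ 2 * D) <= B ->
  lindeberg_error C c e n D m3 m4 beta tail <=
  2 * C * (`|m3| * B * (Num.sqrt n)^-1 + Num.sqrt (B ^+ 2 * (beta + 2) * D^-1)) +
  C * (2 * e * ((beta + 4) * B) + 4 * B * tail +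
    256 * m4 * (m4 * B * (c ^+ 2)^-1 + 3 * B ^+ 2 * n^-1) / e ^+ 2 +
    ((beta + 4) * B) ^+ 2 * n^-1).
Proof.
move=> C0 c0 e0 n0 D0 m40 beta0 tail0.
set x := n / c ^+ 2; set y := n ^+ 2 / (c ^+ 2 * D) => xB yB.
have s0 : 0 < Num.sqrt n by rewrite sqrtr_gt0.
have sE : Num.sqrt n * Num.sqrt n = n by rewrite -expr2 sqr_sqrtr// ltW.
have cn0 : c != 0 by rewrite gt_eqF.
have Dn0 : D != 0 by rewrite gt_eqF.
have en0 : e != 0 by rewrite gt_eqF.
have sn0 : Num.sqrt n != 0 by rewrite gt_eqF.
have c20 : 0 < c ^+ 2 by rewrite exprn_gt0.
have x0 : 0 <= x by apply: divr_ge0; exact: ltW.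
have y0 : 0 <= y by apply: divr_ge0; [exact: sqr_ge0|apply: mulr_ge0; exact: ltW].
have B0 : 0 <= B by exact: le_trans xB.
have xy : beta * x + 4 * y <= (beta + 4) * B.
  have -> : (beta + 4) * B = beta * B + 4 * B by ring.
  by apply: lerD; apply: ler_wpM2l.
have xy0 : 0 <= beta * x + 4 * y by rewrite addr_ge0// mulr_ge0.
have -> : lindeberg_error C c e n D m3 m4 beta tail =
  2 * C * (`|m3| * y * (Num.sqrt n)^-1 +
     n / (c ^+ 2 * D) * Num.sqrt (n * beta + 2 * n ^+ 2 / D)) +
  C * (2 * e * (beta * x + 4 * y) + 4 * x * tail +
    256 * m4 * (m4 * y * (c ^+ 2)^-1 + 3 * y ^+ 2 * n^-1) / e ^+ 2 +
    (beta * x + 4 * y) ^+ 2 * n^-1).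
  rewrite /lindeberg_error /x /y; set q := Num.sqrt (n * beta + _).
  move: q; have := sqr_sqrtr (ltW n0); move: (Num.sqrt n) sn0 => r r0 <- q.
  by field; rewrite en0 r0 Dn0 cn0.
have hs : n / (c ^+ 2 * D) * Num.sqrt (n * beta + 2 * n ^+ 2 / D) <=
    Num.sqrt (B ^+ 2 * (beta + 2) * D^-1).
  have q0 : 0 <= n / (c ^+ 2 * D).
    by apply: divr_ge0; [exact: ltW|apply: mulr_ge0; exact: ltW].
  rewrite -[n / (c ^+ 2 * D)]ger0_norm// -sqrtr_sqr -sqrtrM ?sqr_ge0//.
  have -> : (n / (c ^+ 2 * D)) ^+ 2 * (n * beta + 2 * n ^+ 2 / D) =
      y * (x * beta + 2 * y) / D by rewrite /x /y; field; rewrite Dn0 cn0.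
  apply: ler_wsqrtr; rewrite ler_wpM2r ?invr_ge0 ?(ltW D0)//.
  have -> : B ^+ 2 * (beta + 2) = B * (B * beta + 2 * B) by ring.
  apply: ler_pM => //; first by apply: addr_ge0; exact: mulr_ge0.
  by apply: lerD; [exact: ler_wpM2r|exact: ler_wpM2l].
have inv (z : K) : 0 < z -> 0 <= z^-1 by move=> z0; rewrite invr_ge0 ltW.
apply: lerD.
  apply: ler_wpM2l; first by rewrite mulr_ge0.
  by apply: lerD => //; apply: ler_wpM2r; [exact: inv|exact: ler_wpM2l].
apply: ler_wpM2l => //; apply: lerD.
  apply: lerD; first apply: lerD.
  - by apply: ler_wpM2l => //; apply: mulr_ge0 => //; exact: ltW.
  - by apply: ler_wpM2r => //; exact: ler_wpM2l.
  - apply: ler_wpM2r; first by rewrite invr_ge0 sqr_ge0.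
    apply: ler_wpM2l; first by rewrite mulr_ge0.
    apply: lerD; apply: ler_wpM2r; rewrite ?inv//; first exact: ler_wpM2l.
    by apply: ler_wpM2l => //; rewrite lerXn2r ?nnegrE.
apply: ler_wpM2r; first exact: inv.
by rewrite lerXn2r ?nnegrE// (le_trans xy0).
Qed.

(** * Asymptotics *)

Lemma cvg_natr_inv (K : realType) (n : nat -> nat) : n d @[d --> \oo] --> \oo ->
  ((n d)%:R : K)^-1 @[d --> \oo] --> (0 : K).
Proof.
move=> nI.
have npos : \forall d \near \oo, 0 < (n d)%:R :> K.
  have : \forall d \near \oo, (0 < n d)%N by exact: nI (nbhs_infty_gt 0).
  by apply: filterS => d; rewrite ltr0n.
apply: (gtr0_cvgV0 npos).2; apply/cvgryPge => A.
exact: nI (nbhs_infty_ger A).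
Qed.

Lemma gauss_continuous_var (K : realType) (w a : K) : 0 < w ->
  {for w, continuous (fun u => gauss u a)}.
Proof.
move=> w0; apply: differentiable_continuous; apply/derivable1_diffP.
by have [] := is_derive_gauss_var a w0.
Qed.

Section asymptotics.
Variables (K : realType) (d0 : measure_display) (Omega0 : measurableType d0).
Variables (P0 : probability Omega0 K) (R : {RV P0 >-> K}).
Variables (dO : measure_display) (Omega : measurableType dO) (P : probability Omega K).
Variables (Ri : nat -> {RV P >-> K}).
Variables (V : forall d : nat, nat -> {RV P >-> borel_rV K d}) (n : nat -> nat).
Hypothesis ER1 : \int[P0]_w R w = 0.
Hypothesis ER2 : \int[P0]_w (R w ^+ 2) = 1.
Hypothesis iR4 : P0.-integrable setT (EFin \o (fun w => R w ^+ 4)).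
Hypothesis Ri_law : forall i, same_law (Ri i) R.
Hypothesis Ri_indep : independent_seq P Ri.
Hypothesis V_law : forall d, (0 < d)%N -> forall (i : nat) (j : 'I_d),
  P (V d i @^-1` [set (delta_mx 0 j : 'rV[K]_d)]) = (d%:R^-1)%:E.
Hypothesis V_indep : forall d, (0 < d)%N -> independent_seq P (V d).
Hypothesis RV_indep : forall d, (0 < d)%N ->
  independent2 P (sigma_seq Ri) (sigma_seq (V d)).
Hypothesis n_pos : forall d, (0 < d)%N -> (0 < n d)%N.
Hypothesis n_infty : n d @[d --> \oo] --> \oo.

Let m3 := \int[P0]_w (R w ^+ 3).
Let m4 := \int[P0]_w (R w ^+ 4).
Let beta := \int[P0]_w ((R w ^+ 2 - 1) ^+ 2).

Variables (c : nat -> K) (v B : K).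
Hypothesis v_ge0 : 0 <= v.
Hypothesis c_gt0 : \forall d \near \oo, 0 < c d.
Hypothesis c_infty : (c d ^+ 2)^-1 @[d --> \oo] --> (0 : K).
Hypothesis n_c : \forall d \near \oo, (n d)%:R / c d ^+ 2 <= B.
Hypothesis n2_c : \forall d \near \oo, (n d)%:R ^+ 2 / (c d ^+ 2 * d%:R) <= B.

Let N d : K := (n d)%:R.
Let var d := (N d * beta + 2 * N d * (N d - 1) / d%:R) / c d ^+ 2.
Hypothesis var_cvg : var d @[d --> \oo] --> v.

Let X d t := (enorm (walk Ri (V d) (n d) t) ^+ 2 - N d) / c d.

Let tailR e d := \int[P0]_w ((R w ^+ 2 - 1) ^+ 2 *
  \1_[set y | e / 2 < `|y|] ((R w ^+ 2 - 1) / c d)).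

Let mX d : measurable_fun setT (X d).
Proof.
apply: measurable_funM => //; apply: measurable_funB => //; apply: measurable_funX.
exact: measurable_enorm_walk.
Qed.

Let mcen : measurable_fun setT (fun w => R w ^+ 2 - 1).
Proof. by apply: measurable_funB => //; exact: measurable_funX. Qed.

Let icen2 : P0.-integrable setT (EFin \o (fun w => (R w ^+ 2 - 1) ^+ 2)).
Proof.
apply: (integrable_dominated _ (integrableZl measurableT 2
  (integrableD measurableT (integrable_cstT P0 1) iR4))).
  exact: measurable_funX.
move=> w /=; rewrite ger0_norm ?sqr_ge0// -[4%N]/(2 * 2)%N exprM.
by have := sqr_ge0 (R w ^+ 2 + 1); rewrite !expr2; lra.
Qed.

Let tailR_ge0 e d : 0 <= tailR e d.
Proof.
by apply: Rintegral_ge0 => w _; rewrite mulr_ge0 ?sqr_ge0.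
Qed.

(** Lindeberg's condition: the law of R is fixed and c tends to infinity, so the truncation level e
    c / 2 for R^2 - 1 eventually exceeds any M. *)
Let tailR_cvg e : 0 < e -> tailR e d @[d --> \oo] --> (0 : K).
Proof.
move=> e0; apply/cvgrPdist_le => h h0.
have [M M0 MP] := Rintegral_tail mcen icen2 (fun w => sqr_ge0 _) h0.
(* 1 / c < e / (2 M) is the same as M < e c / 2. *)
have r0 : 0 < (e / (2 * M)) ^+ 2 by rewrite exprn_gt0// divr_gt0// mulr_gt0.
have cI : \forall d \near \oo, (c d ^+ 2)^-1 < (e / (2 * M)) ^+ 2.
  exact: cvgr_lt c_infty _ r0.
near=> d.
have c0 : 0 < c d by near: d.
rewrite sub0r normrN ger0_norm//.
have -> : tailR e d = \int[P0]_w ((R w ^+ 2 - 1) ^+ 2 *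
    \1_[set y | e / 2 * c d < `|y|] (R w ^+ 2 - 1)).
  apply: eq_Rintegral => w _; congr (_ * _); rewrite !indicE; congr (_%:R); congr nat_of_bool.
  apply/idP/idP; rewrite !inE/= normrM normfV (gtr0_norm c0) ltr_pdivlMr//.
apply: MP.
have : (c d ^+ 2)^-1 < (e / (2 * M)) ^+ 2 by near: d.
rewrite -exprVn ltr_pXn2r ?nnegrE ?invr_ge0 ?(ltW c0)//; last first.
  by rewrite divr_ge0 ?(ltW e0)// mulr_ge0// ltW.
rewrite -[ltRHS]invrK ltf_pV2 ?posrE ?invr_gt0 ?divr_gt0 ?mulr_gt0// invf_div.
rewrite ltr_pdivrMr// => Mc.
by rewrite ltW//; lra.
Unshelve. all: by end_near. Qed.

Let d_pos : \forall d \near \oo, (0 < d)%N.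
Proof. exact: nbhs_infty_gt. Qed.

(** The level e is fixed before d: it makes the only non-vanishing term at most h / 2, and the other
    terms, collected in [Z], tend to 0. *)
Let error_cvg (C h : K) : 0 <= C -> 0 < h -> exists2 e, 0 < e &
  \forall d \near \oo, lindeberg_error C (c d) e (N d) d%:R m3 m4 beta (tailR e d) <= h.
Proof.
move=> C0 h0.
have beta0 : 0 <= beta by apply: Rintegral_ge0 => w _; exact: sqr_ge0.
have m40 : 0 <= m4 by apply: Rintegral_ge0 => w _; exact: exprn_even_ge0.
have B0 : 0 <= `|B| by [].
(* The coefficient of e in the error bound is q - 1; the added 1 makes q positive. *)
pose q := C * (2 * ((beta + 4) * `|B|)) + 1.
have q0 : 0 < q by rewrite ltr_wpDl// !mulr_ge0// addr_ge0.
pose e := h / 2 / q; have e0 : 0 < e by rewrite !divr_gt0.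
exists e => //.
pose Z d := 2 * C * (`|m3| * `|B| * (Num.sqrt (N d))^-1 +
    Num.sqrt (`|B| ^+ 2 * (beta + 2) * d%:R^-1)) +
  C * (4 * `|B| * tailR e d +
    256 * m4 * (m4 * `|B| * (c d ^+ 2)^-1 + 3 * `|B| ^+ 2 * (N d)^-1) / e ^+ 2 +
    ((beta + 4) * `|B|) ^+ 2 * (N d)^-1).
have nV : (N d)^-1 @[d --> \oo] --> (0 : K) by exact: cvg_natr_inv.
have dV : (d%:R : K)^-1 @[d --> \oo] --> (0 : K).
  by apply: (@cvg_natr_inv K id); exact: cvg_id.
have sV : (Num.sqrt (N d))^-1 @[d --> \oo] --> (0 : K).
  rewrite -[X in _ --> X]sqrtr0.
  under eq_fun do rewrite -sqrtrV//.
  by apply: (cvg_comp _ _ nV); exact: sqrt_continuous.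
have Z0 : Z d @[d --> \oo] --> (0 : K).
  rewrite [X in _ --> X](_ : 0 = 2 * C * (`|m3| * `|B| * 0 +
    Num.sqrt (`|B| ^+ 2 * (beta + 2) * 0)) +
    C * (4 * `|B| * 0 +
    256 * m4 * (m4 * `|B| * 0 + 3 * `|B| ^+ 2 * 0) / e ^+ 2 +
    ((beta + 4) * `|B|) ^+ 2 * 0)); last by rewrite !mulr0 sqrtr0 !(addr0, mulr0, mul0r).
  apply: cvgD; apply: cvgMl_tmp.
    apply: cvgD; first exact: cvgMl_tmp.
    apply: (@cvg_comp _ _ _ _ (@Num.sqrt K)); last exact: sqrt_continuous.
    exact: cvgMl_tmp.
  apply: cvgD; last exact: cvgMl_tmp.
  apply: cvgD; first by apply: cvgMl_tmp; exact: tailR_cvg.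
  apply: cvgMr_tmp; apply: cvgMl_tmp.
  by apply: cvgD; exact: cvgMl_tmp.
have h2 : 0 < h / 2 by rewrite divr_gt0.
have Zh : \forall d \near \oo, Z d < h / 2 by exact: cvgr_lt Z0 _ h2.
near=> d.
have dp : (0 < d)%N by near: d.
have c0 : 0 < c d by near: d.
have N0 : 0 < N d by rewrite ltr0n n_pos.
have D0 : 0 < d%:R :> K by rewrite ltr0n.
have h3 : N d / c d ^+ 2 <= `|B|.
  by apply: (@le_trans _ _ B); [near: d|exact: ler_norm].
have h4 : N d ^+ 2 / (c d ^+ 2 * d%:R) <= `|B|.
  by apply: (@le_trans _ _ B); [near: d|exact: ler_norm].
apply: (le_trans (lindeberg_error_le m3 C0 c0 e0 N0 D0 m40 beta0 (tailR_ge0 e d) h3 h4)).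
have Zd : Z d < h / 2 by near: d.
have eq : e * (q - 1) <= h / 2.
  have -> : h / 2 = e * q by rewrite /e divfK// gt_eqF.
  by rewrite ler_wpM2l ?(ltW e0)// gerBl.
move: Zd eq; rewrite /Z /q; lra.
Unshelve. all: by end_near. Qed.

Let tail_X d M : (0 < d)%N -> 0 < c d -> 0 < M ->
  \int[P]_t \1_[set y | M < `|y|] (X d t) <= var d / M ^+ 2.
Proof.
case: d => // d' dp c0 M0.
exact: (tail_walk Ri_indep (V_indep dp) (RV_indep dp) Ri_law (V_law dp) iR4 (n d'.+1) ER1 ER2 c0 M0).
Qed.

Let lindeberg_X d w C a e : 0 <= C ->
  (forall w' x, w <= w' -> [/\ gauss w' x <= C, `|gauss1 w' x| <= C & `|gauss2 w' x| <= C]) ->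
  (forall w' x u z, w <= w' -> 0 <= z ->
    `|gauss w' (x + u) - gauss (w' + z) x - u * gauss1 w' x - (u ^+ 2 - z) / 2 * gauss2 w' x|
    <= C * (u ^+ 2 * Num.min 1 `|u| + z ^+ 2)) ->
  (0 < d)%N -> 0 < c d -> 0 < e ->
  `|\int[P]_t gauss w (a - X d t) - gauss (w + var d) a| <=
  lindeberg_error C (c d) e (N d) d%:R m3 m4 beta (tailR e d).
Proof.
case: d => // d' C0 HC HT dp c0 e0.
pose g y := gauss w (a - (y - (n d'.+1)%:R) / c d'.+1).
have mg : measurable_fun setT g.
  apply: (measurableT_comp (measurable_gauss w)); apply: measurable_funB => //.
  by apply: measurable_funM => //; exact: measurable_funB.
rewrite [X in `|X - _|](Rintegral_walk Ri (V_law dp) (n d'.+1) mg).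
(* The kernel is even, which turns a - X into the X - a of [lindeberg_bound]. *)
under eq_Rintegral do rewrite /g -gaussN opprB.
exact: (lindeberg_bound Ri_indep (V_indep dp) (RV_indep dp) Ri_law (V_law dp) iR4
  (n d'.+1) ER1 ER2 a C0 HC HT c0 e0).
Qed.

(** Tightness comes from Chebyshev's inequality. The kernel expectations are close to
    [gauss (w + var d) a], which tends to [gauss (w + v) a], the kernel expectation under N(0,
    v). *)
Lemma walk_cvg_in_law : cvg_in_law P X (centered_normal v).
Proof.
apply: gauss_cvg_in_law => //.
- move=> h h0.
  (* Eventually [var d] < v + 1, and Chebyshev bounds the tail by (v + 1) / M^2 = h. *)
  pose M := Num.sqrt ((v + 1) / h).
  have q0 : 0 < (v + 1) / h by rewrite divr_gt0// ltr_wpDl.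
  have M0 : 0 < M by rewrite sqrtr_gt0.
  exists M.
  have v1 : \forall d \near \oo, var d < v + 1.
    by apply: cvgr_lt var_cvg _ _; rewrite ltrDl.
  near=> d.
  have dp : (0 < d)%N by near: d.
  have c0 : 0 < c d by near: d.
  have vd : var d < v + 1 by near: d.
  apply: (le_trans (tail_X dp c0 M0)).
  rewrite ler_pdivrMr ?exprn_gt0// /M sqr_sqrtr ?(ltW q0)// mulrCA divff ?gt_eqF// mulr1.
  exact: ltW.
- move=> w a w0; rewrite Rintegral_gauss_normal//.
  have [C C0 HC] := gauss_bounds w0.
  have [C' C'0 HT] := gauss_taylor w0.
  pose CC := C + C'; have CC0 : 0 <= CC by exact: addr_ge0.
  have HC2 w' x : w <= w' -> [/\ gauss w' x <= CC, `|gauss1 w' x| <= CC & `|gauss2 w' x| <= CC].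
    by move=> /(HC _ x)[h1 h2 h3 _ _]; rewrite /CC; split; lra.
  have HT2 w' x u z : w <= w' -> 0 <= z ->
      `|gauss w' (x + u) - gauss (w' + z) x - u * gauss1 w' x - (u ^+ 2 - z) / 2 * gauss2 w' x|
      <= CC * (u ^+ 2 * Num.min 1 `|u| + z ^+ 2).
    move=> ww z0; apply: (le_trans (HT w' x u z ww z0)); rewrite ler_wpM2r ?lerDr//.
    by rewrite addr_ge0 ?sqr_ge0// mulr_ge0 ?sqr_ge0// le_min ler01 normr_ge0.
  have gcv : gauss (w + var d) a @[d --> \oo] --> gauss (w + v) a.
    have wv : 0 < w + v by rewrite ltr_wpDr.
    apply: (@cvg_comp _ _ _ (fun d => w + var d) (fun u => gauss u a)); last first.
      exact: gauss_continuous_var wv.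
    by apply: cvgD => //; exact: cvg_cst.
  apply/cvgrPdist_le => h h0.
  have h2 : 0 < h / 2 by rewrite divr_gt0.
  have [e e0 err] := error_cvg CC0 h2.
  have gh : \forall d \near \oo, `|gauss (w + v) a - gauss (w + var d) a| <= h / 2.
    by move/cvgrPdist_le : gcv; exact.
  near=> d.
  have dp : (0 < d)%N by near: d.
  have c0 : 0 < c d by near: d.
  have gd : `|gauss (w + v) a - gauss (w + var d) a| <= h / 2 by near: d.
  have ed : lindeberg_error CC (c d) e (N d) d%:R m3 m4 beta (tailR e d) <= h / 2 by near: d.
  have step := le_trans (lindeberg_X a CC0 HC2 HT2 dp c0 e0) ed.
  rewrite (_ : gauss (w + v) a - _ = (gauss (w + v) a - gauss (w + var d) a) -
    (\int[P]_t gauss w (a - X d t) - gauss (w + var d) a)); last by ring.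
  by rewrite (le_trans (ler_normB _ _))// (splitr h) lerD.
Unshelve. all: by end_near. Qed.

End asymptotics.

Theorem theorem3p7 (K : realType)
  (d0 : measure_display) (Omega0 : measurableType d0)
  (P0 : probability Omega0 K) (R : {RV P0 >-> K})
  (dO : measure_display) (Omega : measurableType dO)
  (P : probability Omega K)
  (Ri : nat -> {RV P >-> K})
  (V : forall d : nat, nat -> {RV P >-> borel_rV K d})
  (n : nat -> nat)
  (hR_mean : ('E_P0[R] = 0)%E)
  (hR_var : ('E_P0[fun w => (R w ^+ 2)%R] = 1)%E)
  (hR_four : ('E_P0[fun w => (R w ^+ 4)%R] < +oo)%E)
  (hRi_law : forall i, same_law (Ri i) R)
  (hRi_indep : independent_seq P Ri)
  (hV_law : forall d, (0 < d)%N -> forall (i : nat) (j : 'I_d),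
     P (V d i @^-1` [set (delta_mx 0 j : 'rV[K]_d)]) = (d%:R^-1)%:E)
  (hV_indep : forall d, (0 < d)%N -> independent_seq P (V d))
  (hRV_indep : forall d, (0 < d)%N ->
     independent2 P (sigma_seq Ri) (sigma_seq (V d)))
  (hn_pos : forall d, (0 < d)%N -> (0 < n d)%N)
  (hn_infty : n d @[d --> \oo] --> \oo) :
  let VarR2 : K := fine ('V_P0[fun w => (R w ^+ 2)%R])%E in
  let S d : nat -> Omega -> 'rV[K]_d := walk Ri (V d) in
  [/\ ((n d)%:R / d%:R : K) @[d --> \oo] --> (0 : K) ->
      cvg_in_law P
        (fun d w => (enorm (S d (n d) w) ^+ 2 - (n d)%:R) / Num.sqrt (n d)%:R)
        (centered_normal VarR2),
      ((n d)%:R / d%:R : K) @[d --> \oo] --> +oo ->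
      cvg_in_law P
        (fun d w => (enorm (S d (n d) w) ^+ 2 - (n d)%:R)
                    / Num.sqrt (2 * (n d)%:R ^+ 2 / d%:R))
        (centered_normal 1)
    & forall gamma : K, 0 < gamma ->
      ((n d)%:R / d%:R : K) @[d --> \oo] --> gamma ->
      cvg_in_law P
        (fun d w => (enorm (S d (n d) w) ^+ 2 - (n d)%:R) / Num.sqrt (n d)%:R)
        (centered_normal (2 * gamma + VarR2))].
Proof.
move=> VarR2 S.
have ER1 : \int[P0]_w R w = 0.
  by move: hR_mean; rewrite unlock /Rintegral => ->.
have ER2 : \int[P0]_w (R w ^+ 2) = 1.
  by move: hR_var; rewrite unlock /Rintegral => ->.
have iR4 : P0.-integrable setT (EFin \o (fun w => R w ^+ 4)).
  apply/integrableP; split; first by apply/measurable_EFinP; exact: measurable_funX.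
  move: hR_four; rewrite unlock; congr (_ < _)%E; apply: eq_integral => w _ /=.
  by rewrite ger0_norm// exprn_even_ge0.
have VE : VarR2 = \int[P0]_w ((R w ^+ 2 - 1) ^+ 2).
  by rewrite /VarR2 /variance unlock hR_var unlock.
have V0 : 0 <= VarR2 by rewrite VE; apply: Rintegral_ge0 => w _; exact: sqr_ge0.
have dV : (d%:R : K)^-1 @[d --> \oo] --> (0 : K).
  by apply: (@cvg_natr_inv K id); exact: cvg_id.
have nV := @cvg_natr_inv K n hn_infty.
have d_pos : \forall d \near \oo, (0 < d)%N by exact: nbhs_infty_gt.
(* (a) and (c) share the scale sqrt n, and (a) is the case gamma = 0. Here n / c^2 = 1 and n^2 /
   (c^2 d) = n / d, hence the bound gamma + 1. *)
have ac (gamma : K) : 0 <= gamma -> ((n d)%:R / d%:R : K) @[d --> \oo] --> gamma ->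
    cvg_in_law P
      (fun d w => (enorm (S d (n d) w) ^+ 2 - (n d)%:R) / Num.sqrt (n d)%:R)
      (centered_normal (2 * gamma + VarR2)).
  move=> g0 gcv.
  apply: (walk_cvg_in_law ER1 ER2 iR4 hRi_law hRi_indep hV_law hV_indep hRV_indep
    hn_pos hn_infty (B := gamma + 1)).
  - by rewrite addr_ge0// mulr_ge0.
  - by apply: filterS d_pos => d dp; rewrite sqrtr_gt0 ltr0n hn_pos.
  - by under eq_fun do rewrite sqr_sqrtr//.
  - apply: filterS d_pos => d dp; rewrite sqr_sqrtr// divff ?lerDr//.
    by rewrite pnatr_eq0 -lt0n hn_pos.
  - have : \forall d \near \oo, ((n d)%:R / d%:R : K) < gamma + 1.
      by apply: cvgr_lt gcv _ _; rewrite ltrDl.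
    apply: filterS2 d_pos => d dp /ltW; congr (_ <= _).
    rewrite sqr_sqrtr//; field.
    by rewrite !pnatr_eq0 -!lt0n dp hn_pos.
  - rewrite -VE.
    have H : (VarR2 + 2 * ((n d)%:R / d%:R - d%:R^-1)) @[d --> \oo] --> 2 * gamma + VarR2.
      rewrite addrC; apply: cvgD; first exact: cvg_cst.
      apply: cvgMl_tmp; rewrite -[X in _ --> X]subr0; exact: cvgB.
    apply: cvg_trans H; apply: near_eq_cvg; apply: filterS d_pos => d dp /=.
    rewrite sqr_sqrtr//; field.
    by rewrite !pnatr_eq0 -!lt0n dp hn_pos.
split.
- by move=> /(ac 0 (lexx 0)); rewrite mulr0 add0r.
(* With c^2 = 2 n^2 / d everything is governed by d / n, which tends to 0: n / c^2 = (d / n) / 2,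
   n^2 / (c^2 d) = 1 / 2, and 1 / c^2 is d / n divided by 2 n. In the total variance, Var(R^2)
   carries the factor d / n and disappears. *)
- move=> ncv.
  have dn : (d%:R / (n d)%:R : K) @[d --> \oo] --> (0 : K).
    under eq_fun do rewrite -invf_div.
    apply: (gtr0_cvgV0 _).2 => //.
    by apply: filterS d_pos => d dp; rewrite divr_gt0// ltr0n// hn_pos.
  have c2 d : (0 < d)%N -> Num.sqrt (2 * (n d)%:R ^+ 2 / d%:R) ^+ 2 = 2 * (n d)%:R ^+ 2 / d%:R :> K.
    by move=> dp; rewrite sqr_sqrtr// divr_ge0// mulr_ge0// sqr_ge0.
  have nz d : (0 < d)%N -> (d%:R != 0 :> K) && ((n d)%:R != 0 :> K).
    by move=> dp; rewrite !pnatr_eq0 -!lt0n dp hn_pos.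
  apply: (walk_cvg_in_law ER1 ER2 iR4 hRi_law hRi_indep hV_law hV_indep hRV_indep
    hn_pos hn_infty (B := 1)) => //.
  - apply: filterS d_pos => d dp; rewrite sqrtr_gt0 divr_gt0 ?ltr0n//.
    by rewrite mulr_gt0// exprn_gt0// ltr0n hn_pos.
  - have H : (2^-1 * ((n d)%:R^-1 * (d%:R / (n d)%:R)) : K) @[d --> \oo] --> (0 : K).
      rewrite [X in _ --> X](_ : 0 = 2^-1 * (0 * 0)); last by rewrite !mulr0.
      by apply: cvgMl_tmp; exact: cvgM.
    apply: cvg_trans H; apply: near_eq_cvg; apply: filterS d_pos => d dp /=.
    by rewrite c2//; have /andP[dz nz0] := nz d dp; field; rewrite dz nz0.
  - have : \forall d \near \oo, (d%:R / (n d)%:R : K) < 1 by exact: cvgr_lt dn _ ltr01.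
    apply: filterS2 d_pos => d dp dn1; rewrite c2//.
    have -> : (n d)%:R / (2 * (n d)%:R ^+ 2 / d%:R) = 2^-1 * (d%:R / (n d)%:R) :> K.
      by have /andP[dz nz0] := nz d dp; field; rewrite dz nz0.
    by have : 0 <= d%:R / (n d)%:R :> K; [exact: divr_ge0|lra].
  - apply: filterS d_pos => d dp; rewrite c2//.
    have -> : (n d)%:R ^+ 2 / (2 * (n d)%:R ^+ 2 / d%:R * d%:R) = 2^-1 :> K.
      by have /andP[dz nz0] := nz d dp; field; rewrite dz nz0.
    by rewrite invf_le1// ler1n.
  - have H : (VarR2 / 2 * (d%:R / (n d)%:R) + (1 - (n d)%:R^-1)) @[d --> \oo] --> (1 : K).
      rewrite [X in _ --> X](_ : 1 = VarR2 / 2 * 0 + (1 - 0)); last by rewrite mulr0 add0r subr0.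
      apply: cvgD; first exact: cvgMl_tmp.
      by apply: cvgB => //; exact: cvg_cst.
    apply: cvg_trans H; apply: near_eq_cvg; apply: filterS d_pos => d dp /=.
    by rewrite c2// -VE; have /andP[dz nz0] := nz d dp; field; rewrite dz nz0.
- by move=> gamma /ltW; exact: ac.
Qed.
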